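(* For every $(x_1,x_2)\in H^2(Cay)$ and every $y\in Im(Cay)$, we have $u(y,0)(x_1,x_2)=(x'_1,x'_2)$, where $$x'_1=((1-y)x_1 + y)(-yx_1 +1+y)^{-1}$$ and $$x'_2=(x_2(1-\overline{x_1}))\big[(1-\overline{x_1})^{-1}(-yx_1+1+y)^{-1}\big].$$
   Context: **Octonions.** $Cay$ is the 8-dimensional non-associative (alternative) real division algebra with basis $e_0=1,e_1,\dots,e_7$ and relations: $e_0e_i=e_ie_0=e_i$ for all $i$; $e_i^2=-e_0$ for $i>0$; $e_ie_j=-e_je_i$ for $i,j>0$, $i\ne j$; $e_2e_6=e_3e_4=e_5e_7=e_1$ together with all relations deduced from these by cyclic permutations of the indices $1,2,\dots,7$. For $x=a+\sum_{i=1}^7 b_ie_i$: conjugate $\overline{x}=a-\sum_{i=1}^7 b_ie_i$, norm $N(x)=x\overline{x}=a^2+\sum b_i^2$, modulus $|x|=\sqrt{N(x)}$, imaginary part $Im(x)=\frac{x-\overline{x}}{2}$, inverse $x^{-1}=\overline{x}/N(x)$ for $x\neq 0$. $Im(Cay)=\{x\in Cay: x=Im(x)\}$. Real numbers are identified with multiples of $1$. **Projective plane.** $P^2(Cay)$ is the disjoint union of $Cay\times Cay$ (points at finite distance) and the set of points at infinity $\{(u):u\in Cay\cup\{\infty\}\}$. Its lines are: $[u,v]=\{(x,y)\in Cay\times Cay:y=ux+v\}\cup\{(u)\}$ for $u,v\in Cay$; $[u]=\{(x,y)\in Cay\times Cay:x=u\}\cup\{(\infty)\}$ for $u\in Cay$;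 and $[\infty]$, the set of all points at infinity. A collineation is a bijection of $P^2(Cay)$ onto itself preserving the set of lines. **Polarity and hyperbolic plane.** A polarity is a bijection $\Pi$ from points to lines such that, if $a$ runs through a line, then $\Pi(a)$ runs in the sheaf of lines through a given point, and $a\in\Pi(b)\Leftrightarrow b\in\Pi(a)$; it acts on lines by sending a line $L$ to the common point of the lines $\Pi(a)$, $a\in L$. Let $\Pi$ be the polarity of $P^2(Cay)$ given by $\Pi(x,y)=[-\overline{xy^{-1}},\overline{y^{-1}}]$ if $y\ne0$, $\Pi(x,0)=[\overline{x^{-1}}]$ if $x\neq0$, $\Pi(0,0)=[\infty]$ (its values at points at infinity are then forced: $\Pi((\infty))=[0,0]$, $\Pi((0))=[0]$, $\Pi((u))=[-\overline{u^{-1}},0]$ for $u\in Cay\setminus\{0\}$). The hyperbolic plane is $H^2(Cay)=\{(x_1,x_2)\in Cay\times Cay:|x_1|^2+|x_2|^2<1\}$. Let $G$ be its automorphism group, i.e. the group of collineations of $P^2(Cay)$ commuting with $\Pi$; it is a simple Lie group isomorphic to $F_{4(-20)}$ and it acts on $H^2(Cay)$. **The groups $A$ and $N$.** For $t\in\mathbb{R}$, $a_t\in G$ is the element acting on $H^2(Cay)$ by $$a_t(x_1,x_2)= \big((\cosh(t)x_1 + \sinh(t))(\sinh(t)x_1+\cosh(t))^{-1},\ x_2(\sinh(t)x_1+\cosh(t))^{-1}\big).$$ $A=\{a_t:t\in\mathbb{R}\}$ is the split one-parameter group in an Iwasawa decomposition $G=KAN$, where $K$ is the stabilizer of $(0,0)$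 in $G$. Write $a_t=\exp(tX)$ with $X$ in the Lie algebra $\mathfrak{g}$ of $G$. Let $\mathfrak{g}_\alpha,\mathfrak{g}_{2\alpha}\subset\mathfrak{g}$ be the eigenspaces of $\mathrm{ad}(X)$ for the eigenvalues $1$ and $2$ (of real dimensions 8 and 7), and $N=\exp(\mathfrak{g}_\alpha\oplus\mathfrak{g}_{2\alpha})$, a 2-step nilpotent group of dimension 15. The group $AN$ acts simply transitively on $H^2(Cay)$. **The elements $u(y,z)$.** There are linear parametrizations $\mathfrak{g}_\alpha=\{Z(z):z\in Cay\}$, $\mathfrak{g}_{2\alpha}=\{Y(y):y\in Im(Cay)\}$ (due to Takahashi), and one sets $u(y,z)=\exp(Y(y)+Z(z))=\exp(Y(y))\exp(Z(z))$, so that $N=\{u(y,z):y\in Im(Cay),z\in Cay\}$ and the centre of $N$ is $Z(N)=\{u(y,0):y\in Im(Cay)\}$. With this parametrization, $u(y,z)$ is the unique element of $N$ such that $$u(y,z)(0,0)=\Big(\big(\tfrac{|z|^2}{2}+y\big)\big(1+\tfrac{|z|^2}{2}+y\big)^{-1},\ z\big(1+\tfrac{|z|^2}{2}+y\big)^{-1}\Big).$$ *)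

(* Defs.v *)
From HB Require Import structures.
From mathcomp Require Import all_boot all_order all_algebra.
From mathcomp Require Import all_classical all_reals all_analysis.

Set Implicit Arguments.
Unset Strict Implicit.
Unset Printing Implicit Defensive.

Import Order.TTheory GRing.Theory Num.Theory.
Import numFieldNormedType.Exports.

Local Open Scope classical_set_scope.
Local Open Scope ring_scope.

(** * Octonions *)

(* The octonion with coordinates x 0 0, ..., x 0 7 in the basis e_0, ..., e_7.
   Only the additive, scalar and topological structures of the row vectors are
   used; the library norm `|x| on them is the sup norm, NOT the octonion
   modulus, which is [cabs] below. *)
Notation Cay R := 'rV[R]_8.

Section Octonions.
Variable R : realType.
Implicit Types x y : Cay R.

Definition cbase (i : 'I_8) : Cay R := delta_mx 0 i.

(* Indices 1, ..., 7 are read modulo 7. The relations e_2 e_6 = e_3 e_4 =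
   e_5 e_7 = e_1 and their cyclic shifts say that e_i e_{i+4} = e_{i+6},
   e_i e_{i+1} = e_{i+5} and e_i e_{i+2} = e_{i+3}; anticommutativity gives
   the three remaining differences. See [cbase_mul_rel]. *)
Definition cidx (k : nat) : 'I_8 := inord ((k + 6) %% 7).+1.

Definition cbase_mul (i j : 'I_8) : Cay R :=
  if i == 0 then cbase j
  else if j == 0 then cbase i
  else match ((j + 7 - i) %% 7)%N with
       | 1 => cbase (cidx (i + 5))
       | 2 => cbase (cidx (i + 3))
       | 4 => cbase (cidx (i + 6))
       | 3 => - cbase (cidx (i + 2))
       | 5 => - cbase (cidx (i + 1))
       | 6 => - cbase (cidx (i + 4))
       | _ => - cbase 0
       end.

Definition cmul x y : Cay R :=
  \sum_(i < 8) \sum_(j < 8) (x 0 i * y 0 j) *: cbase_mul i j.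

Definition creal (r : R) : Cay R := r *: cbase 0.

Definition cconj x : Cay R := \row_i (if i == 0 then x 0 i else - x 0 i).

Definition cnorm x : R := \sum_(i < 8) x 0 i ^+ 2.

Definition cabs x : R := Num.sqrt (cnorm x).

(* [cinv 0] is [0]. *)
Definition cinv x : Cay R := (cnorm x)^-1 *: cconj x.

Definition cIm x : Cay R := 2^-1 *: (x - cconj x).

Definition ImCay : set (Cay R) := [set x | x = cIm x].

Lemma cmul_base i j : cmul (cbase i) (cbase j) = cbase_mul i j.
Proof.
rewrite /cmul (bigD1 i) //= (bigD1 j) //= big1 => [|k kj]; last first.
  by rewrite /cbase !mxE /= (negbTE kj) mulr0 scale0r.
rewrite big1 => [|k ki]; last first.
  by apply: big1 => l _; rewrite /cbase !mxE /= (negbTE ki) mul0r scale0r.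
by rewrite /cbase !mxE !eqxx mulr1 scale1r !addr0.
Qed.

Lemma cbase_mul_rel (k : 'I_7) :
  [/\ cbase_mul (cidx (k + 2)) (cidx (k + 6)) = cbase (cidx (k + 1)),
      cbase_mul (cidx (k + 3)) (cidx (k + 4)) = cbase (cidx (k + 1)) &
      cbase_mul (cidx (k + 5)) (cidx (k + 7)) = cbase (cidx (k + 1))].
Proof.
have cidxE n : (cidx n : nat) = ((n + 6) %% 7).+1.
  by rewrite inordK // ltnS ltn_pmod.
have cidx0 n : (cidx n == 0) = false by apply/eqP => /(congr1 val); rewrite /= cidxE.
rewrite /cbase_mul !cidx0 !cidxE.
by case: k; do 7?[case=> [|]] => //= *; split; congr cbase; apply: val_inj;
  rewrite /= !cidxE.
Qed.

Lemma cbase_mul_anti (i j : 'I_8) :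
  i != 0 -> j != 0 -> i != j -> cbase_mul i j = - cbase_mul j i.
Proof.
have eq_val (a b : 'I_8) : (a == b) = (a == b :> nat) by [].
rewrite /cbase_mul !eq_val; case: i j => [i i8] [j j8] /=.
by do 8?[case: i i8 => [|i] i8] => //=; do 8?[case: j j8 => [|j] j8] => //= _ _ _;
  rewrite ?opprK; (congr cbase || congr (- cbase _)); apply: val_inj;
  rewrite /= !inordK.
Qed.

Lemma cbase_mul_sqr (i : 'I_8) : i != 0 -> cbase_mul i i = - cbase 0.
Proof. by move=> i0; rewrite /cbase_mul (negbTE i0) addKn. Qed.

End Octonions.

Declare Scope cay_scope.
Delimit Scope cay_scope with cay.
Notation "x '*o' y" := (cmul x y) (at level 40, left associativity) : cay_scope.
Local Open Scope cay_scope.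

(** * The projective plane, the polarity and the group G *)

Inductive cpoint (R : realType) : Type :=
  | Aff of Cay R & Cay R        (* (x, y) *)
  | Slope of Cay R              (* (u) *)
  | SlopeInf.                   (* (oo) *)
Arguments SlopeInf {R}.

Inductive cline (R : realType) : Type :=
  | Line of Cay R & Cay R       (* [u, v] *)
  | LineV of Cay R              (* [u] *)
  | LineInf.                    (* [oo] *)
Arguments LineInf {R}.

Section Plane.
Variable R : realType.

Definition on_line (l : cline R) : set (cpoint R) :=
  match l with
  | Line u v => [set p | (exists x, p = Aff x (u *o x + v)) \/ p = Slope u]
  | LineV u => [set p | (exists y, p = Aff u y) \/ p = SlopeInf]
  | LineInf => [set p | (exists u, p = Slope u) \/ p = SlopeInf]
  end.

Definition lines : set (set (cpoint R)) := range on_line.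

Definition collineation (g : cpoint R -> cpoint R) : Prop :=
  bijective g /\ [set g @` l | l in lines] = lines.

Definition polarity (p : cpoint R) : cline R :=
  match p with
  | Aff x y =>
      if y != 0 then Line (- cconj (x *o cinv y)) (cconj (cinv y))
      else if x != 0 then LineV (cconj (cinv x))
      else LineInf
  | Slope u => if u != 0 then Line (- cconj (cinv u)) 0 else LineV 0
  | SlopeInf => Line 0 0
  end.

Definition H2 : set (Cay R * Cay R) :=
  [set p | cabs p.1 ^+ 2 + cabs p.2 ^+ 2 < 1].

Definition G : set (cpoint R -> cpoint R) :=
  [set g | collineation g /\
           forall p, g @` on_line (polarity p) = on_line (polarity (g p))].

(* Affine coordinates of a point. The value at infinity is irrelevant: this is
   applied only to images under G of points of the hyperbolic plane. *)
Definition coords (p : cpoint R) : Cay R * Cay R :=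
  if p is Aff x y then (x, y) else (0, 0).

(** * The Lie algebra of G

   An element of the Lie algebra of G is a one-parameter subgroup of G. It is
   represented by its fundamental vector field
     V p = d/ds (phi s p) at s = 0
   on the open subset H2 of Cay x Cay. This is faithful, since an element of G
   is determined by its restriction to H2. Vector fields are total functions;
   only their values on H2 matter. *)

Definition one_param_subgroup (phi : R -> cpoint R -> cpoint R)
    (V : Cay R * Cay R -> Cay R * Cay R) : Prop :=
  [/\ forall s, G (phi s),
      forall s t, phi (s + t) = phi s \o phi t &
      forall p, H2 p ->
        is_derive (0 : R) 1 (fun s => coords (phi s (Aff p.1 p.2))) (V p)].

(* The differentiability clause holds for every one-parameter subgroup of the
   Lie group G; it is recorded so that Lie brackets make sense. *)
Definition lieG : set (Cay R * Cay R -> Cay R * Cay R) :=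
  [set V | (forall p, H2 p -> differentiable V p) /\
           exists phi, one_param_subgroup phi V].

(* For a left action, V |-> (fundamental vector field) reverses the sign of
   brackets, so ad(X) V = [X, V] is the opposite of the usual bracket
   DV.X - DX.V of vector fields. *)
Definition ad (X V : Cay R * Cay R -> Cay R * Cay R) (p : Cay R * Cay R) :
    Cay R * Cay R :=
  'd X p (V p) - 'd V p (X p).

(** * The groups A and N, and the elements u(y, z) *)

Definition cosh (t : R) : R := (expR t + expR (- t)) / 2.
Definition sinh (t : R) : R := (expR t - expR (- t)) / 2.

Definition a_ (t : R) (p : Cay R * Cay R) : Cay R * Cay R :=
  let q := cinv (sinh t *: p.1 + creal (cosh t)) in
  ((cosh t *: p.1 + creal (sinh t)) *o q, p.2 *o q).

(* The element X such that a_t = exp(tX). *)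
Definition XA (p : Cay R * Cay R) : Cay R * Cay R := derive1 (fun t => a_ t p) 0.

Definition root_space (lambda : R) : set (Cay R * Cay R -> Cay R * Cay R) :=
  [set V | lieG V /\ forall p, H2 p -> ad XA V p = lambda *: V p].

(* exp V is phi 1, where phi is the one-parameter subgroup generated by V. *)
Definition N : set (cpoint R -> cpoint R) :=
  [set g | exists V1 V2 phi,
     [/\ root_space 1 V1, root_space 2 V2,
         one_param_subgroup phi (fun p => V1 p + V2 p) & g = phi 1]].

(* The element of N that sends (0, 0) to the given point. *)
Definition u (y z : Cay R) : cpoint R -> cpoint R :=
  let w := creal (cabs z ^+ 2 / 2) + y in
  xget (id : {classic cpoint R -> cpoint R}) [set g | N g /\
    g (Aff 0 0) = Aff (w *o cinv (creal 1 + w)) (z *o cinv (creal 1 + w))].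

End Plane.

(* Main.v *)
(* With [b = 1 - x1], the Siegel coordinates of [(x1, x2)] are
   [(b^-1, x2 b^-1)]. The formula to be proved is the translation
   [(z, w) |-> (z + y, w)] in these coordinates; it is a collineation commuting
   with the polarity because Siegel coordinates are themselves obtained by
   collineations, and its one-parameter group has its velocity in [g_2alpha].

   The main point is that an element [g] of N is determined by [g (0, 0)].
   In Siegel coordinates centred at [1/2], [a_t] is the dilation
   [(z, w) |-> (e^(2t) z, e^t w)], so a root vector field is homogeneous along
   its orbits and [a_-t g a_t] tends to the identity. Compose [g] with the
   inverse translation to get [k] in G fixing the origin. Such a [k] preserves
   the line at infinity and the unit ball, hence it is additive (parallelograms)
   and isometric. Since [a_-t k a_t] tends to the identity, the expansion of
   [k (a_t p)] near the boundary point [(1, 0)] shows that [k] is the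
   identity. *)
Require Import Defs.
From HB Require Import structures.
From mathcomp Require Import all_boot all_order all_algebra.
From mathcomp Require Import all_classical all_reals all_analysis.
From mathcomp Require Import ring lra.
Import Order.TTheory GRing.Theory Num.Theory.
Import numFieldNormedType.Exports.
Local Open Scope classical_set_scope.
Local Open Scope ring_scope.
Local Open Scope cay_scope.

Set Implicit Arguments.
Unset Strict Implicit.
Unset Printing Implicit Defensive.

(** * Octonions *)

(** [u y 0] is a chosen element of [N], and [N] is given only by differential equations; neither a
    description of the root spaces nor a structure theorem for [G] or for the stabilizer of the
    origin is used, so uniqueness has to come from homogeneity alone. Write [f] for the action of
    [k] on [Cay x Cay]. The orbit point [q n], with [e^t = n + 1], approaches [(1, 0)] so that its
    first coordinate differs from [1] at order [n^-2], while its second one has order [n^-1]. As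
    [a_-t g a_t] tends to the identity, [f (q n)] has the same leading terms: composing with the
    inverse translation shifts a Siegel coordinate of size [n^2] by a bounded amount. Order [0]
    gives that [f] fixes [(1, 0)], order [1] that it fixes every [(0, x)], and order [2] that it
    fixes [(x, 0)] when [Re x > 0], which is enough by additivity. Additivity alone does not give
    real linearity, hence the integral values of [e^t]: the factors [n + 1] and [(n + 1)^2] can then
    be moved through [f]. *)

Section Octonions.
Variable R : realType.
Implicit Types (x y z : Cay R) (a : R).

(** Natural-number indices keep coordinates literal, so that the multiplication table can be
    evaluated and [ring] sees eight atoms per octonion. *)
Definition crd x (k : nat) : R := x 0 (inord k).

Lemma crdP x y : (forall k, (k < 8)%N -> crd x k = crd y k) -> x = y.
Proof.
move=> xy; apply/rowP => i; have := xy i (ltn_ord i).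
by rewrite /crd inord_val.
Qed.

Lemma crdD x y k : crd (x + y) k = crd x k + crd y k.
Proof. by rewrite /crd mxE. Qed.
Lemma crdN x k : crd (- x) k = - crd x k.
Proof. by rewrite /crd mxE. Qed.
Lemma crdZ a x k : crd (a *: x) k = a * crd x k.
Proof. by rewrite /crd mxE. Qed.
Lemma crd0 k : crd 0 k = 0.
Proof. by rewrite /crd mxE. Qed.
Lemma crd_conj x k : (k < 8)%N ->
  crd (cconj x) k = if k == 0%N then crd x k else - crd x k.
Proof. by move=> k8; rewrite /crd mxE -val_eqE /= inordK. Qed.
Lemma crd_base (i : 'I_8) k : (k < 8)%N -> crd (cbase R i) k = (k == i)%:R.
Proof. by move=> k8; rewrite /crd mxE eqxx -val_eqE /= inordK. Qed.
Lemma crd_real a k : (k < 8)%N -> crd (creal a) k = if k == 0%N then a else 0.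
Proof.
by move=> k8; rewrite crdZ crd_base //=; case: k k8 => *; rewrite (mulr1, mulr0).
Qed.
Lemma crd_sum I (r : seq I) (F : I -> Cay R) k :
  crd (\sum_(i <- r) F i) k = \sum_(i <- r) crd (F i) k.
Proof. by rewrite /crd summxE. Qed.

Lemma sum8E (V : zmodType) (F : 'I_8 -> V) : \sum_i F i =
  F (inord 0) + F (inord 1) + F (inord 2) + F (inord 3) + F (inord 4) +
  F (inord 5) + F (inord 6) + F (inord 7).
Proof.
rewrite !big_ord_recr big_ord0 /= add0r.
by do !congr (_ + _); congr F; apply: val_inj; rewrite /= inordK.
Qed.

Lemma cnormE x : cnorm x =
  crd x 0 ^+ 2 + crd x 1 ^+ 2 + crd x 2 ^+ 2 + crd x 3 ^+ 2 +
  crd x 4 ^+ 2 + crd x 5 ^+ 2 + crd x 6 ^+ 2 + crd x 7 ^+ 2.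
Proof. by rewrite /cnorm sum8E. Qed.

(** The index and, in [mul_neg], the sign of [e_i e_j], stated on natural numbers so that the table
    computes. The default case of the match is [e_i e_i = -1]. *)
Definition mul_idx (i j : nat) : nat :=
  if i == 0%N then j else if j == 0%N then i else
  match ((j + 7 - i) %% 7)%N with
  | 1 => ((i + 5 + 6) %% 7).+1
  | 2 => ((i + 3 + 6) %% 7).+1
  | 4 => ((i + 6 + 6) %% 7).+1
  | 3 => ((i + 2 + 6) %% 7).+1
  | 5 => ((i + 1 + 6) %% 7).+1
  | 6 => ((i + 4 + 6) %% 7).+1
  | _ => 0
  end.

Definition mul_neg (i j : nat) : bool :=
  [&& i != 0%N, j != 0%N & ((j + 7 - i) %% 7)%N \in [:: 0; 3; 5; 6]%N].

Lemma cbase_mulE (i j : 'I_8) :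
  cbase_mul R i j =
  (if mul_neg i j then -%R else id) (cbase R (inord (mul_idx i j))).
Proof.
rewrite /cbase_mul /mul_neg /mul_idx -!val_eqE /=.
case: eqP => _ /=; first by rewrite inord_val.
case: eqP => _ /=; first by rewrite inord_val.
have : ((j + 7 - i) %% 7 < 7)%N by rewrite ltn_mod.
have inord0 : inord 0 = 0 :> 'I_8 by apply: val_inj; rewrite /= inordK.
rewrite /cidx; case: (_ %% _)%N => [|[|[|[|[|[|[|]]]]]]] // _ /=.
by rewrite inord0.
Qed.

Definition mul_terms (k : nat) : seq (nat * nat) :=
  [seq p <- [seq (i, j) | i <- iota 0 8, j <- iota 0 8] | mul_idx p.1 p.2 == k].

Lemma crd_mul_terms x y k : (k < 8)%N -> crd (x *o y) k =
  \sum_(p <- mul_terms k)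
     (if mul_neg p.1 p.2 then -%R else id) (crd x p.1 * crd y p.2).
Proof.
move=> k8; rewrite big_filter big_mkcond big_allpairs /cmul crd_sum.
have ordE (F : nat -> R) : \sum_(i <- iota 0 8) F i = \sum_(i < 8) F i.
  by rewrite -(big_mkord xpredT).
rewrite ordE; apply: eq_bigr => i _; rewrite crd_sum ordE.
apply: eq_bigr => j _; rewrite crdZ cbase_mulE /=.
have idx8 : (mul_idx i j < 8)%N.
  rewrite /mul_idx; case: eqP => _ //; case: eqP => _ //.
  by case: (_ %% _)%N => [|[|[|[|[|[|[|]]]]]]]; rewrite // !ltnS -ltnS ltn_pmod.
rewrite /crd !inord_val -!/(crd _ _) eq_sym.
by case: mul_neg; rewrite ?crdN crd_base // inordK //; case: eqP;
  rewrite ?mulrN ?(mulr1, mulr0, oppr0).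
Qed.

(** A product of equations, rather than a conjunction, can be used as a multi-rule by [rewrite].
    Each equation comes from evaluating the list of pairs [(i, j)] for which [e_i e_j] is [e_k] up
    to sign. *)
Lemma crd_mul x y :
  ((crd (x *o y) 0 =
   (crd x 0 * crd y 0 - crd x 1 * crd y 1 - crd x 2 * crd y 2
    - crd x 3 * crd y 3 - crd x 4 * crd y 4 - crd x 5 * crd y 5
    - crd x 6 * crd y 6 - crd x 7 * crd y 7)%R) *
  (crd (x *o y) 1 =
   (crd x 0 * crd y 1 + crd x 1 * crd y 0 + crd x 2 * crd y 6
    + crd x 3 * crd y 4 - crd x 4 * crd y 3 + crd x 5 * crd y 7
    - crd x 6 * crd y 2 - crd x 7 * crd y 5)%R) *
  (crd (x *o y) 2 =
   (crd x 0 * crd y 2 - crd x 1 * crd y 6 + crd x 2 * crd y 0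
    + crd x 3 * crd y 7 + crd x 4 * crd y 5 - crd x 5 * crd y 4
    + crd x 6 * crd y 1 - crd x 7 * crd y 3)%R) *
  (crd (x *o y) 3 =
   (crd x 0 * crd y 3 - crd x 1 * crd y 4 - crd x 2 * crd y 7
    + crd x 3 * crd y 0 + crd x 4 * crd y 1 + crd x 5 * crd y 6
    - crd x 6 * crd y 5 + crd x 7 * crd y 2)%R) *
  (crd (x *o y) 4 =
   (crd x 0 * crd y 4 + crd x 1 * crd y 3 - crd x 2 * crd y 5
    - crd x 3 * crd y 1 + crd x 4 * crd y 0 + crd x 5 * crd y 2
    + crd x 6 * crd y 7 - crd x 7 * crd y 6)%R) *
  (crd (x *o y) 5 =
   (crd x 0 * crd y 5 - crd x 1 * crd y 7 + crd x 2 * crd y 4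
    - crd x 3 * crd y 6 - crd x 4 * crd y 2 + crd x 5 * crd y 0
    + crd x 6 * crd y 3 + crd x 7 * crd y 1)%R) *
  (crd (x *o y) 6 =
   (crd x 0 * crd y 6 + crd x 1 * crd y 2 - crd x 2 * crd y 1
    + crd x 3 * crd y 5 - crd x 4 * crd y 7 - crd x 5 * crd y 3
    + crd x 6 * crd y 0 + crd x 7 * crd y 4)%R) *
  (crd (x *o y) 7 =
   (crd x 0 * crd y 7 + crd x 1 * crd y 5 + crd x 2 * crd y 3
    - crd x 3 * crd y 2 + crd x 4 * crd y 6 - crd x 5 * crd y 1
    - crd x 6 * crd y 4 + crd x 7 * crd y 0)%R))%type.
Proof.
by do !split; rewrite crd_mul_terms //;
  match goal with |- context [mul_terms ?k] =>
    let l := eval vm_compute in (mul_terms k) in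
    rewrite (_ : mul_terms k = l) // end;
  rewrite !big_cons big_nil /= addr0 !addrA.
Qed.

Lemma crd_conjE x :
  ((crd (cconj x) 0 = crd x 0) * (crd (cconj x) 1 = (- crd x 1)%R) *
   (crd (cconj x) 2 = (- crd x 2)%R) * (crd (cconj x) 3 = (- crd x 3)%R) *
   (crd (cconj x) 4 = (- crd x 4)%R) * (crd (cconj x) 5 = (- crd x 5)%R) *
   (crd (cconj x) 6 = (- crd x 6)%R) * (crd (cconj x) 7 = (- crd x 7)%R))%type.
Proof. by do !split; rewrite crd_conj. Qed.

Lemma crd_realE a :
  ((crd (creal a) 0 = a) * (crd (creal a) 1 = 0) *
   (crd (creal a) 2 = 0) * (crd (creal a) 3 = 0) *
   (crd (creal a) 4 = 0) * (crd (creal a) 5 = 0) *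
   (crd (creal a) 6 = 0) * (crd (creal a) 7 = 0))%type.
Proof. by do !split; rewrite crd_real. Qed.

Definition crdE :=
  (@crdD, @crdN, @crdZ, @crd0, @crd_mul, @crd_conjE, @crd_realE).

Lemma cay_eqP x y :
  [/\ crd x 0 = crd y 0, crd x 1 = crd y 1, crd x 2 = crd y 2 &
      crd x 3 = crd y 3] ->
  [/\ crd x 4 = crd y 4, crd x 5 = crd y 5, crd x 6 = crd y 6 &
      crd x 7 = crd y 7] -> x = y.
Proof.
by move=> [? ? ? ?] [? ? ? ?]; apply: crdP; do 8![case=> [_ //|]].
Qed.

End Octonions.

Ltac oct := apply: cay_eqP; split; rewrite ?cnormE !crdE; ring.

(* Linear identities between octonions, products being atoms. *)
Ltac lin := apply: crdP => ? _; rewrite ?(crdD, crdN, crdZ, crd0); ring.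

(** * Identities of the alternative algebra, norms and inverses *)

Section Algebra.
Variable R : realType.
Implicit Types (x y z : Cay R) (a : R).

Lemma cmulDl x y z : (x + y) *o z = x *o z + y *o z. Proof. oct. Qed.
Lemma cmulDr x y z : x *o (y + z) = x *o y + x *o z. Proof. oct. Qed.
Lemma cmulNl x y : - x *o y = - (x *o y). Proof. oct. Qed.
Lemma cmulNr x y : x *o - y = - (x *o y). Proof. oct. Qed.
Lemma cmulZl a x y : (a *: x) *o y = a *: (x *o y). Proof. oct. Qed.
Lemma cmulZr a x y : x *o (a *: y) = a *: (x *o y). Proof. oct. Qed.
Lemma cmul_reall a x : creal a *o x = a *: x. Proof. oct. Qed.
Lemma cmul_realr a x : x *o creal a = a *: x. Proof. oct. Qed.
Lemma cmul0l x : 0 *o x = 0. Proof. oct. Qed.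
Lemma cmul0r x : x *o 0 = 0. Proof. oct. Qed.
Lemma cmulBl x y z : (x - y) *o z = x *o z - y *o z.
Proof. by rewrite cmulDl cmulNl. Qed.
Lemma cmulBr x y z : x *o (y - z) = x *o y - x *o z.
Proof. by rewrite cmulDr cmulNr. Qed.
Lemma cmul1l x : creal 1 *o x = x. Proof. by rewrite cmul_reall scale1r. Qed.
Lemma cmul1r x : x *o creal 1 = x. Proof. by rewrite cmul_realr scale1r. Qed.

Lemma cconjK : involutive (@cconj R). Proof. by move=> x; oct. Qed.
Lemma cconjD x y : cconj (x + y) = cconj x + cconj y. Proof. oct. Qed.
Lemma cconjN x : cconj (- x) = - cconj x. Proof. oct. Qed.
Lemma cconjZ a x : cconj (a *: x) = a *: cconj x. Proof. oct. Qed.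
Lemma cconj_real a : cconj (creal a) = creal a. Proof. oct. Qed.
Lemma cconj0 : cconj 0 = 0 :> Cay R. Proof. oct. Qed.
Lemma cconj_mul x y : cconj (x *o y) = cconj y *o cconj x. Proof. oct. Qed.

Lemma crealD a b : creal (a + b) = creal a + creal b.
Proof. by rewrite /creal scalerDl. Qed.
Lemma crealZ a b : a *: creal b = creal (a * b).
Proof. by rewrite /creal scalerA. Qed.
Lemma creal0 : creal 0 = 0 :> Cay R.
Proof. by rewrite /creal scale0r. Qed.

Lemma cnorm_mul x y : cnorm (x *o y) = cnorm x * cnorm y.
Proof. by rewrite !cnormE !crdE; ring. Qed.
Lemma cnorm_conj x : cnorm (cconj x) = cnorm x.
Proof. by rewrite !cnormE !crdE; ring. Qed.
Lemma cnormZ a x : cnorm (a *: x) = a ^+ 2 * cnorm x.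
Proof. by rewrite !cnormE !crdE; ring. Qed.
Lemma cnormN x : cnorm (- x) = cnorm x.
Proof. by rewrite !cnormE !crdE; ring. Qed.
Lemma cnorm_real a : cnorm (creal a) = a ^+ 2.
Proof. by rewrite !cnormE !crdE; ring. Qed.
Lemma cnorm0 : cnorm 0 = 0 :> R.
Proof. by rewrite !cnormE !crdE; ring. Qed.
Lemma cnorm_subr x a : cnorm (x - creal a) = cnorm x - 2 * a * crd x 0 + a ^+ 2.
Proof. by rewrite !cnormE !crdE; ring. Qed.
Lemma cnorm_ge0 x : 0 <= cnorm x.
Proof. by apply: sumr_ge0 => i _; apply: sqr_ge0. Qed.

Lemma sqr_crd_le_cnorm x i : x 0 i ^+ 2 <= cnorm x.
Proof.
rewrite /cnorm (bigD1 i) //= lerDl; apply: sumr_ge0 => j _; exact: sqr_ge0.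
Qed.

Lemma cnorm_eq0 x : (cnorm x == 0) = (x == 0).
Proof.
apply/eqP/eqP => [x0|->]; last exact: cnorm0.
apply/rowP => i; rewrite mxE; apply/eqP; rewrite -sqrf_eq0 eq_le sqr_ge0 andbT.
by rewrite -x0 sqr_crd_le_cnorm.
Qed.

Lemma cnorm_gt0 x : (0 < cnorm x) = (x != 0).
Proof. by rewrite lt_def cnorm_ge0 andbT cnorm_eq0. Qed.

Lemma creal1_neq0 : creal 1 != 0 :> Cay R.
Proof. by rewrite -cnorm_eq0 cnorm_real expr1n oner_eq0. Qed.

Lemma cmulKr_conj x y : (y *o x) *o cconj x = cnorm x *: y. Proof. oct. Qed.
Lemma cmulKl_conj x y : cconj x *o (x *o y) = cnorm x *: y.
Proof.
apply: (can_inj cconjK).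
by rewrite !cconj_mul cmulKr_conj cnorm_conj cconjZ.
Qed.

Lemma cconjE x : cconj x = creal (2 * crd x 0) - x. Proof. oct. Qed.

(** Expand [cmulKr_conj] at [y + z] and remove the two diagonal terms. *)
Lemma cmulKr_polar x y z :
  (x *o y) *o cconj z + (x *o z) *o cconj y =
  (cnorm (y + z) - cnorm y - cnorm z) *: x.
Proof.
rewrite !scalerBl -!cmulKr_conj cconjD !cmulDr !cmulDl; lin.
Qed.

(** Since [cconj y] is a real number minus [y], the identity [(x y) (cconj y) = |y|^2 x = x (y
    (cconj y))] turns into right alternativity. *)
Lemma cmul_altr x y : (x *o y) *o y = x *o (y *o y).
Proof.
have E := cmulKr_conj y x; have := cmulKr_conj y (creal 1).
rewrite cmul1l => /(congr1 (cmul x)).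
rewrite (cmulZr _ x (creal 1)) cmul1r -E cconjE !cmulBr !cmul_realr.
by rewrite (cmulZr _ x y) => /eqP; rewrite (inj_eq (addrI _)) eqr_opp => /eqP.
Qed.

Lemma cmul_altl x y : y *o (y *o x) = (y *o y) *o x.
Proof. by apply: (can_inj cconjK); rewrite !cconj_mul cmul_altr. Qed.

Lemma cmul_conj x : x *o cconj x = creal (cnorm x).
Proof. by rewrite -{1}[x]cmul1l cmulKr_conj crealZ mulr1. Qed.

(* By [cmulKr_polar] with [cconj y] for [z], both sides reduce to
   [2 <cconj y, z> xy - |y|^2 x (cconj z)]. *)
Lemma moufang_right x y z : x *o (y *o z *o y) = ((x *o y) *o z) *o y.
Proof.
have E t : (t *o z) *o y =
    (cnorm (z + cconj y) - cnorm z - cnorm (cconj y)) *: t -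
    (t *o cconj y) *o cconj z.
  by rewrite -cmulKr_polar cconjK addrK.
rewrite (E y) (E (x *o y)) cmul_conj cmulKr_conj cmulBr cmul_reall.
by rewrite (cmulZr _ x y) (cmulZr _ x) cmulZl.
Qed.

Lemma cmul_flex x y : (x *o y) *o x = x *o (y *o x).
Proof. oct. Qed.

Lemma cinv0 : cinv 0 = 0 :> Cay R.
Proof. by rewrite /cinv cconj0 scaler0. Qed.

Lemma cnorm_inv x : cnorm (cinv x) = (cnorm x)^-1.
Proof.
have [->|x0] := eqVneq x 0; first by rewrite cinv0 cnorm0 invr0.
rewrite -cnorm_eq0 in x0.
by rewrite cnormZ cnorm_conj expr2 -mulrA mulVf // mulr1.
Qed.

Lemma cinv_eq0 x : (cinv x == 0) = (x == 0).
Proof. by rewrite -!cnorm_eq0 cnorm_inv invr_eq0. Qed.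

Lemma cinvK : involutive (@cinv R).
Proof.
move=> x; have [->|x0] := eqVneq x 0; first by rewrite !cinv0.
rewrite -cnorm_eq0 in x0.
by rewrite {1}/cinv cnorm_inv invrK cconjZ cconjK scalerA mulfV // scale1r.
Qed.

Lemma cmulKr x y : x != 0 -> (y *o x) *o cinv x = y.
Proof.
by rewrite -cnorm_eq0 => x0; rewrite cmulZr cmulKr_conj scalerA mulVf // scale1r.
Qed.

Lemma cmulVKr x y : x != 0 -> (y *o cinv x) *o x = y.
Proof. by move=> x0; rewrite -{2}[x]cinvK cmulKr // cinv_eq0. Qed.

Lemma cmulKl x y : x != 0 -> cinv x *o (x *o y) = y.
Proof.
by rewrite -cnorm_eq0 => x0; rewrite cmulZl cmulKl_conj scalerA mulVf // scale1r.
Qed.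

Lemma cmulVKl x y : x != 0 -> x *o (cinv x *o y) = y.
Proof. by move=> x0; rewrite -{1}[x]cinvK cmulKl // cinv_eq0. Qed.

Lemma cmulxV x : x != 0 -> x *o cinv x = creal 1.
Proof. by move=> x0; rewrite -{1}[x]cmul1l cmulKr. Qed.

Lemma cmulVx x : x != 0 -> cinv x *o x = creal 1.
Proof. by move=> x0; rewrite -{2}[x]cmul1r cmulKl. Qed.

Lemma cinv_mul x y : cinv (x *o y) = cinv y *o cinv x.
Proof.
by rewrite /cinv cnorm_mul cconj_mul cmulZl cmulZr scalerA invfM mulrC.
Qed.

Lemma cinv_real a : cinv (creal a) = creal a^-1.
Proof.
rewrite /cinv cnorm_real cconj_real crealZ; congr creal.
by have [->|a0] := eqVneq a 0; rewrite ?invr0 ?mulr0 // expr2 invfM mulfVK.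
Qed.

Lemma cinvZ a x : cinv (a *: x) = a^-1 *: cinv x.
Proof.
by rewrite -!cmul_reall cinv_mul cinv_real cmul_realr cmul_reall.
Qed.

Lemma cinvN x : cinv (- x) = - cinv x.
Proof. by rewrite -scaleN1r cinvZ invrN invr1 scaleN1r. Qed.

Lemma cinv_conj x : cinv (cconj x) = cconj (cinv x).
Proof. by rewrite /cinv cnorm_conj cconjZ. Qed.

Lemma cmul_eq0 x y : (x *o y == 0) = (x == 0) || (y == 0).
Proof. by rewrite -!cnorm_eq0 cnorm_mul mulf_eq0. Qed.

Lemma cconj_eq0 x : (cconj x == 0) = (x == 0).
Proof. by rewrite -!cnorm_eq0 cnorm_conj. Qed.

End Algebra.
Arguments cconjK {R}.
Arguments cinvK {R}.

(** * Collineations *)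

Section Collineations.
Variable R : realType.
Implicit Types (x y z : Cay R) (p : Defs.cpoint R) (l : cline R).

(** Incidence by cases, free of the existentials of [on_line], so that it reduces on
    constructors. *)
Definition incident l p : Prop :=
  match l, p with
  | Line u v, Aff x y => y = u *o x + v
  | Line u _, Slope w => w = u
  | LineV u, Aff x _ => x = u
  | LineV _, SlopeInf | LineInf, Slope _ | LineInf, SlopeInf => True
  | _, _ => False
  end.

Lemma on_lineE l p : on_line l p = incident l p.
Proof.
apply/propext; case: l => [u v|u|]; case: p => [x y|w|] /=; split => //.
all: try by case=> [[? []]|].
all: try by case=> [[? []]|[]].
all: try by right.
all: try by left; eexists.
all: try by move=> ->; right.
all: try by move=> ->; left; eexists.
all: try by case=> [[? [-> ->]]|].

Qed.

(** The map on lines is carried along explicitly: compatibility with the polarity then becomes an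
    equality of lines instead of an equality of point sets. *)
Definition line_action (g : Defs.cpoint R -> Defs.cpoint R)
    (gl : cline R -> cline R) :=
  [/\ bijective g, bijective gl & forall l, g @` on_line l = on_line (gl l)].

Lemma line_actionI g g' gl gl' :
  cancel g g' -> cancel g' g -> cancel gl gl' -> cancel gl' gl ->
  (forall l p, incident l p -> incident (gl l) (g p)) ->
  (forall l p, incident l p -> incident (gl' l) (g' p)) ->
  line_action g gl.
Proof.
move=> gK g'K glK gl'K gi g'i; split; [by exists g'|by exists gl'|].
move=> l; apply/seteqP; split=> [_ [p lp <-]|p].
  by move: lp; rewrite !on_lineE; apply: gi.
rewrite on_lineE => /g'i; rewrite glK => lp.
by exists (g' p); rewrite ?on_lineE.
Qed.

Lemma line_action_comp g gl f fl :
  line_action g gl -> line_action f fl -> line_action (g \o f) (gl \o fl).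
Proof.
move=> [bg bgl ig] [bf bfl jf]; split; [exact: bij_comp|exact: bij_comp|].
by move=> l; rewrite -image_comp jf ig.
Qed.

Lemma line_action_G g gl : line_action g gl ->
  (forall p, gl (polarity p) = polarity (g p)) -> G g.
Proof.
move=> [bg [gl' glK gl'K] ig] gpol; split; last by move=> p; rewrite ig gpol.
split=> //; apply/seteqP; split=> [_ [_ [l _ <-] <-]|_ [l _ <-]].
  by rewrite ig; exists (gl l).
exists (on_line (gl' l)); last by rewrite ig gl'K.
by exists (gl' l).
Qed.

Lemma G_id : @G R id.
Proof.
apply: (@line_action_G _ id) => //.
by apply: (@line_actionI _ id _ id).
Qed.

Lemma G_comp (g f : Defs.cpoint R -> Defs.cpoint R) : G g -> G f -> G (g \o f).
Proof.
move=> [[bg lg] pg] [[bf lf] pf]; split; last first.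
  by move=> p; rewrite -image_comp pf pg.
split; first exact: bij_comp.
rewrite -[RHS]lg -[in RHS]lf; apply/seteqP; split.
  by move=> _ [l Ll <-]; exists (f @` l); [exists l|rewrite image_comp].
by move=> _ [_ [l Ll <-] <-]; exists l => //; rewrite image_comp.
Qed.

(** Takes the tangent line [x = 1] at the boundary point [(1, 0)] to [x = 0], which [invert_pt] then
    sends to infinity. *)
Definition reflect_pt p := match p with
  | Aff x y => Aff (creal 1 - x) y
  | Slope u => Slope (- u)
  | SlopeInf => SlopeInf
  end.

Definition reflect_ln l := match l with
  | Line u v => Line (- u) (u + v)
  | LineV u => LineV (creal 1 - u)
  | LineInf => LineInf
  end.

Lemma reflect_ptK : involutive reflect_pt.
Proof. by case=> [x y|u|] //=; rewrite ?opprK // subKr. Qed.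

Lemma reflect_lnK : involutive reflect_ln.
Proof. by case=> [u v|u|] //=; rewrite ?subKr // opprK addKr. Qed.

Lemma reflect_action : line_action reflect_pt reflect_ln.
Proof.
have I l p : incident l p -> incident (reflect_ln l) (reflect_pt p).
  case: l p => [u v|u|] [x y|w|] //= -> //.
  by rewrite cmulBr cmul1r !cmulNl; lin.
exact: (line_actionI reflect_ptK reflect_ptK reflect_lnK reflect_lnK I I).
Qed.

(** Heuristically, [(1 : x : y)] becomes [(x : 1 : y)], which exchanges the line [x = 0] with the
    line at infinity. *)
Definition invert_pt p := match p with
  | Aff x y => if x == 0 then Slope y else Aff (cinv x) (y *o cinv x)
  | Slope u => Aff 0 u
  | SlopeInf => SlopeInf
  end.

Definition invert_ln l := match l with
  | Line u v => Line v u
  | LineV u => if u == 0 then LineInf else LineV (cinv u)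
  | LineInf => LineV 0
  end.

Lemma invert_ptK : involutive invert_pt.
Proof.
case=> [x y|u|] //=; last by rewrite eqxx.
have [->//|x0] := eqVneq x 0.
by rewrite /= cinv_eq0 (negbTE x0) cinvK cmulVKr.
Qed.

Lemma invert_lnK : involutive invert_ln.
Proof.
case=> [u v|u|] //=; last by rewrite eqxx.
have [->//|u0] := eqVneq u 0.
by rewrite /= cinv_eq0 (negbTE u0) cinvK.
Qed.

Lemma invert_action : line_action invert_pt invert_ln.
Proof.
have I l p : incident l p -> incident (invert_ln l) (invert_pt p).
  case: l p => [u v|u|] [x y|w|] //=.
  - move=> ->; have [->|x0] := eqVneq x 0 => /=.
      by rewrite cmul0r add0r.
    by rewrite cmulDl cmulKr // addrC.
  - by move=> ->; rewrite cmul0r add0r.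
  - by move=> ->; have [|] := eqVneq u 0.
  - by have [|] := eqVneq u 0.
exact: (line_actionI invert_ptK invert_ptK invert_lnK invert_lnK I I).
Qed.

Definition shift_pt a p := match p with
  | Aff x y => Aff (x + a) y
  | Slope u => Slope u
  | SlopeInf => SlopeInf
  end.

Definition shift_ln a l := match l with
  | Line u v => Line u (v - u *o a)
  | LineV u => LineV (u + a)
  | LineInf => LineInf
  end.

Lemma shift_ptD a b p : shift_pt (a + b) p = shift_pt a (shift_pt b p).
Proof. by case: p => [x y|u|] //=; rewrite -addrA (addrC b). Qed.

Lemma shift_pt0 p : shift_pt 0 p = p.
Proof. by case: p => [x y|u|] //=; rewrite addr0. Qed.

Lemma shift_action a : line_action (shift_pt a) (shift_ln a).
Proof.
have Kp b : cancel (shift_pt b) (shift_pt (- b)).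
  by move=> p; rewrite -shift_ptD addNr shift_pt0.
have Kl b : cancel (shift_ln b) (shift_ln (- b)).
  by case=> [u v|u|] //=; rewrite ?addrK // cmulNr opprK subrK.
have I b l p : incident l p -> incident (shift_ln b l) (shift_pt b p).
  case: l p => [u v|u|] [x y|w|] //= -> //.
  by rewrite cmulDr; lin.
have := line_actionI (Kp a) _ (Kl a) _ (I a) (I (- a)).
by apply; [move: (Kp (- a))|move: (Kl (- a))]; rewrite opprK.
Qed.

(* In the coordinates [invert_pt (reflect_pt p)] the quadric bounding [H2] is
   [2 Re x = 1 + |y|^2], and this is the polarity that it defines. *)
Definition siegel_polarity p := match p with
  | Aff x y =>
      if y == 0 then LineV (creal 1 - cconj x)
      else Line (cconj (cinv y)) (cconj (cinv y) *o (cconj x - creal 1))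
  | Slope u => if u == 0 then LineInf else Line 0 (cconj (cinv u))
  | SlopeInf => Line 0 0
  end.

(** The special branches come from [x = 1], which is sent to infinity, and from [y = 0] and [x = 0],
    where [polarity] changes form. *)
Lemma polarity_siegel p :
  invert_ln (reflect_ln (polarity p)) =
  siegel_polarity (invert_pt (reflect_pt p)).
Proof.
have c11 := creal1_neq0 R.
case: p => [x y|u|] /=; last first.
- by rewrite oppr0 addr0.
- have [->|u0] /= := eqVneq u 0.
    by rewrite cconj0 oppr0 eqxx !addr0 (negbTE c11) cinv_real invr1.
  rewrite oppr_eq0 (negbTE u0) addr0 opprK cinvN cconjN.
  by rewrite cconj0 sub0r cmulNr cmul1r opprK.
have [->|y0] /= := eqVneq y 0; last first.
  rewrite opprK cconj_mul -(cinv_conj y).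
  have [x1|x1] := eqVneq (creal 1 - x) 0.
    have -> : x = creal 1 by apply/esym/eqP; rewrite -subr_eq0 x1.
    by rewrite /= (negbTE y0) cconj_real cmul1r addrC subrr cinv_conj.
  rewrite /= cmul_eq0 cinv_eq0 (negbTE x1) (negbTE y0) /=.
  rewrite cinv_mul cinvK cconj_mul -!cinv_conj.
  congr Line; last by rewrite cmulBr cmulKr ?cconj_eq0 // cmul1r;
    rewrite cconjD cconjN cconj_real cmulBr cmul1r; lin.
  by rewrite cconjD cconjN cconj_real cmulBr cmul1r addrC.
have [->|x0] /= := eqVneq x 0.
  by rewrite subr0 (negbTE c11) /= cmul0l eqxx cinv_real invr1 cconj_real subrr.
have [x1|x1] := eqVneq (creal 1 - x) 0.
  have -> : x = creal 1 by apply/esym/eqP; rewrite -subr_eq0 x1.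
  by rewrite cinv_real invr1 cconj_real subrr /= !eqxx.
have E : creal 1 - cconj (cinv x) = - cconj ((creal 1 - x) *o cinv x).
  by rewrite cmulBl cmul1l cmulxV // cconjD cconjN cconj_real opprB.
have F : x *o cinv (creal 1 - x) = cinv (creal 1 - x) - creal 1.
  apply/eqP; rewrite eq_sym subr_eq [X in _ == X]addrC -subr_eq.
  by have /eqP := cmulxV x1; rewrite cmulBl cmul1l.
rewrite cmul0l /= eqxx E oppr_eq0 cconj_eq0 cmul_eq0 cinv_eq0 (negbTE x1).
rewrite (negbTE x0) cinvN cinv_conj cinv_mul cinvK F cconjD cconjN cconj_real.
by rewrite opprB.
Qed.

(** Conjugating back uses the same two maps because both are involutions. *)
Definition vertical a :=
  reflect_pt \o (invert_pt \o (shift_pt a \o (invert_pt \o reflect_pt))).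

Lemma verticalD a b : vertical (a + b) = vertical a \o vertical b.
Proof.
by apply: funext => p; rewrite /vertical /= reflect_ptK invert_ptK shift_ptD.
Qed.

Lemma vertical0 : vertical 0 = id.
Proof.
by apply: funext => p; rewrite /vertical /= shift_pt0 invert_ptK reflect_ptK.
Qed.

Lemma ImCay_conj x : ImCay x -> cconj x = - x.
Proof.
rewrite /ImCay /= /cIm => xE; rewrite {1}xE cconjZ cconjD cconjN cconjK.
by rewrite [in RHS]xE -scalerN opprB.
Qed.

(** A purely imaginary translation leaves [Re x] invariant, hence also the quadric
    [2 Re x = 1 + |y|^2]. *)
Lemma siegel_polarity_shift a p : cconj a = - a ->
  siegel_polarity (shift_pt a p) = shift_ln a (siegel_polarity p).
Proof.
move=> aE; case: p => [x y|u|] /=; last by rewrite cmul0l subr0.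
  case: eqVneq => _ /=; rewrite cconjD aE ?cmulBr ?cmulDr ?cmulNr.
    by congr LineV; lin.
  by congr Line; lin.
by case: eqVneq => //= _; rewrite cmul0l subr0.
Qed.

Lemma vertical_G a : ImCay a -> G (vertical a).
Proof.
move=> /ImCay_conj aE; pose gl := reflect_ln \o (invert_ln \o
  (shift_ln a \o (invert_ln \o reflect_ln))).
apply: (@line_action_G _ gl) => [|p].
  have := (reflect_action, invert_action, shift_action a) => -[[ra ia] sa].
  by do !apply: line_action_comp.
rewrite /gl /= polarity_siegel -siegel_polarity_shift //.
set q := shift_pt _ _; rewrite -[q in LHS]invert_ptK -[invert_pt q]reflect_ptK.
by rewrite -polarity_siegel invert_lnK reflect_lnK.
Qed.
End Collineations.

(** * Interior points *)

Section Interior.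
Variable R : realType.
Implicit Types (x y z : Cay R) (p q : Defs.cpoint R) (a b : R).

Lemma cconj_cinv x : cconj (cinv x) = (cnorm x)^-1 *: x.
Proof. by rewrite /cinv cconjZ cconjK. Qed.

Lemma cnorm_affine a b x :
  cnorm (a *: x + creal b) = a ^+ 2 * cnorm x + 2 * a * b * crd x 0 + b ^+ 2.
Proof. by rewrite !cnormE !crdE; ring. Qed.

(** A weighted Cauchy-Schwarz inequality, whose defect is the norm of [a *: x - b *: y]. *)
Lemma cnormD_le a b x y :
  a * b * cnorm (x + y) <= (a + b) * (a * cnorm x + b * cnorm y).
Proof.
rewrite -subr_ge0; suff -> : (a + b) * (a * cnorm x + b * cnorm y) -
  a * b * cnorm (x + y) = cnorm (a *: x - b *: y) by exact: cnorm_ge0.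
by rewrite !cnormE !crdE; ring.
Qed.

Lemma H2E (p : Cay R * Cay R) : H2 p = (cnorm p.1 + cnorm p.2 < 1) :> Prop.
Proof. by rewrite /H2 /= /cabs !sqr_sqrtr ?cnorm_ge0. Qed.

(* The unit sphere is the set of absolute points, and its interior consists of
   the points whose polar line does not meet it: both notions are invariant
   under collineations commuting with the polarity. *)
Definition absolute p := incident (polarity p) p.

Definition interior p := forall q, incident (polarity p) q -> ~ absolute q.

(** For [y] nonzero, [(x, y)] lies on its polar line iff [y = ((1 - |x|^2) / |y|^2) *: y]. *)
Lemma absoluteP p :
  absolute p <-> if p is Aff x y then cnorm x + cnorm y = 1 else False.
Proof.
rewrite /absolute; case: p => [x y|u|] //=; last first.
  have [//|u0] := eqVneq u 0; rewrite /= cconj_cinv.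
  split=> // /eqP; rewrite -subr_eq0 opprK -{1}[u]scale1r -scalerDl scaler_eq0.
  rewrite (negbTE u0) orbF gt_eqF // ltr_wpDr // invr_ge0 cnorm_ge0 //.
have [->|y0] := eqVneq y 0; last first.
  rewrite /= cconj_mul cconj_cinv cmulZl cmulNl.
  rewrite cmulZl -[in X in _ *: (_ *o X)](cconjK x) cmulKr_conj cnorm_conj.
  have Y0 : cnorm y != 0 by rewrite cnorm_eq0.
  rewrite scalerA -scaleNr -scalerDl; split=> [/eqP|E].
    rewrite -{1}[y]scale1r -subr_eq0 -scalerBl scaler_eq0 (negbTE y0) orbF.
    rewrite subr_eq0 => /eqP /(congr1 (fun t : R => t * cnorm y)).
    by rewrite mul1r mulrDl mulNr mulrAC !mulVf // mul1r => ->; ring.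
  suff -> : - ((cnorm y)^-1 * cnorm x) + (cnorm y)^-1 = 1 by rewrite scale1r.
  apply: (mulIf Y0); rewrite mul1r mulrDl mulNr mulrAC !mulVf // mul1r.
  by rewrite -E; ring.
have [->|x0] := eqVneq x 0.
  by rewrite /= cnorm0 addr0; split=> // /esym /eqP; rewrite oner_eq0.
have X0 : cnorm x != 0 by rewrite cnorm_eq0.
rewrite /= cnorm0 addr0 cconj_cinv; split=> [/eqP|->]; last first.
  by rewrite invr1 scale1r.
rewrite -{1}[x]scale1r -subr_eq0 -scalerBl scaler_eq0 (negbTE x0) orbF.
by rewrite subr_eq0 => /eqP E; rewrite -[LHS]invrK -E invr1.
Qed.

Lemma interiorP p :
  interior p <-> if p is Aff x y then cnorm x + cnorm y < 1 else False.
Proof.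
split; last first.
  case: p => // x y S1 q; have X_ge0 := cnorm_ge0 x; have Y_ge0 := cnorm_ge0 y.
  move=> + /absoluteP; case: q => // x' y'.
  have X'_ge0 := cnorm_ge0 x'; have Y'_ge0 := cnorm_ge0 y'.
  rewrite /=; have [->|y0] := eqVneq y 0; last first.
    have Y_gt0 : 0 < cnorm y by rewrite cnorm_gt0.
    rewrite /= cconj_mul cconj_cinv cmulZl cmulNl cmulZl => y'E S'1.
    have E : (cnorm y)^-1 *: y = y' + (cnorm y)^-1 *: ((y *o cconj x) *o x').
      by rewrite y'E; lin.
    (* With these weights the sum on the right is [|x|^2 (|x'|^2 + |y'|^2) = |x|^2], which leaves
       [|x|^2 <= (|x|^2 + |y|^2) |x|^2]; hence the separate case [x = 0]. *)
    have := cnormD_le (cnorm x) (cnorm y) y' ((cnorm y)^-1 *: (y *o cconj x *o x')).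
    rewrite -E !cnormZ !cnorm_mul cnorm_conj.
    have -> : cnorm x * cnorm y * ((cnorm y)^-1 ^+ 2 * cnorm y) = cnorm x.
      by field; rewrite gt_eqF.
    have -> : cnorm x * cnorm y' + cnorm y * ((cnorm y)^-1 ^+ 2 *
      (cnorm y * cnorm x * cnorm x')) = cnorm x * (cnorm x' + cnorm y').
      by field; rewrite gt_eqF.
    rewrite S'1 mulr1; have [X0|X0] := eqVneq x 0.
      move: E S1; rewrite X0 cconj0 cmul0r cmul0l scaler0 addr0 => E S1 _.
      have := congr1 (@cnorm R) E; rewrite cnormZ expr2 -mulrA mulVf ?gt_eqF //.
      rewrite mulr1 => Y'E; move: S1; rewrite cnorm0 add0r.
      by rewrite ltNge -[_ <= _]invf_le1 // Y'E; lra.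
    have X_gt0 : 0 < cnorm x by rewrite cnorm_gt0.
    by rewrite -[X in X <= _]mul1r ler_pM2r // leNgt S1.
  have [//|x0] := eqVneq x 0; rewrite /= cconj_cinv => E S'1.
  have X_gt0 : 0 < cnorm x by rewrite cnorm_gt0.
  have X'E : cnorm x' = (cnorm x)^-1.
    by rewrite E cnormZ expr2 -mulrA mulVf ?mulr1 // gt_eqF.
  have: cnorm x < 1 by lra.
  by rewrite ltNge -invf_le1 // -X'E => /negP; apply; lra.
(* Conversely, the polar line of every other point is shown to carry an absolute point. *)
move=> pI; have ex q : incident (polarity p) q -> absolute q -> False by move/pI.
case: p pI ex => [x y|u|] _ ex; last first.
- apply: (ex (Aff (creal 1) 0)) => /=; first by rewrite cmul0l addr0.
  by apply/absoluteP; rewrite cnorm_real cnorm0 expr1n addr0.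
- have [u0|u0] := eqVneq u 0.
    apply: (ex (Aff 0 (creal 1))) => /=; first by rewrite u0 eqxx.
    by apply/absoluteP; rewrite cnorm_real cnorm0 expr1n add0r.
  pose r := Num.sqrt (1 + (cnorm u)^-1)^-1.
  have d_gt0 : 0 < 1 + (cnorm u)^-1 by rewrite ltr_wpDr // invr_ge0 cnorm_ge0.
  apply: (ex (Aff (creal r) (- cconj (cinv u) *o creal r))) => /=.
    by rewrite u0 /= addr0.
  apply/absoluteP; rewrite cnorm_mul cnormN cnorm_conj cnorm_inv cnorm_real.
  rewrite sqr_sqrtr ?invr_ge0 ?(ltW d_gt0) // -{1}[_^-1]mul1r -mulrDl.
  by rewrite mulfV // gt_eqF.
apply: contrapT => /negP; rewrite -leNgt => S1.
pose S := cnorm x + cnorm y; have S_gt0 : 0 < S by apply: lt_le_trans S1.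
have iS1 : S^-1 <= 1 by rewrite invf_le1.
have [y0|y0] := eqVneq y 0.
  rewrite /S y0 cnorm0 addr0 in S_gt0 iS1.
  have x0 : x != 0 by rewrite -cnorm_gt0.
  pose r := Num.sqrt (1 - (cnorm x)^-1).
  apply: (ex (Aff (cconj (cinv x)) (creal r))).
    by rewrite y0 /= eqxx x0.
  apply/absoluteP; rewrite cnorm_conj cnorm_inv cnorm_real sqr_sqrtr ?subr_ge0 //.
  by rewrite addrC subrK.
have Y_gt0 : 0 < cnorm y by rewrite cnorm_gt0.
(* The orthogonal projection of the origin to the polar line is moved along
   this line up to the unit sphere. *)
pose r := Num.sqrt ((1 - S^-1) * cnorm y / S).
have rE : r ^+ 2 = (1 - S^-1) * cnorm y / S.
  rewrite sqr_sqrtr // divr_ge0 ?(ltW S_gt0) // mulr_ge0 ?(ltW Y_gt0) //.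
  by rewrite subr_ge0.
apply: (ex (Aff (S^-1 *: x + creal r)
  (y *o ((- (r / cnorm y)) *: cconj x + creal S^-1)))) => /=.
  have K : (y *o cconj x) *o x = cnorm x *: y.
    by rewrite -{2}[x]cconjK cmulKr_conj cnorm_conj.
  rewrite y0 /= cconj_mul cconj_cinv !cmulDr !cmul_realr.
  rewrite !cmulZl (cmulZr _ _ x) (cmulZr _ y) cmulNl cmulZl K.
  apply: crdP => k _; rewrite !(crdD, crdN, crdZ) /S; field.
  by rewrite !gt_eqF.
apply/absoluteP; rewrite cnorm_mul !cnorm_affine cnorm_conj sqrrN exprMn rE.
rewrite crdE /S; field.
by rewrite !gt_eqF.
Qed.

Lemma G_incident g p q : G g ->
  incident (polarity (g p)) (g q) <-> incident (polarity p) q.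
Proof.
move=> [[/bij_inj gI _] gpol]; rewrite -!on_lineE -gpol.
split=> [[q' ? /gI <-]//|pq].
by exists q.
Qed.

(** Interior points are characterized by incidence and polarity, both preserved by [g]. On such
    images [coords] never takes its default value. *)
Lemma G_H2 g (p : Cay R * Cay R) : G g -> H2 p ->
  exists2 q : Cay R * Cay R, H2 q & g (Aff p.1 p.2) = Aff q.1 q.2.
Proof.
move=> Gg; rewrite H2E => /(interiorP (Aff p.1 p.2)).2 pI.
suff /interiorP : interior (g (Aff p.1 p.2)).
  by case: (g _) => // x y xy; exists (x, y) => //; rewrite H2E.
have [[[g' gK g'K] _] _] := Gg.
move=> q; rewrite -[q]g'K => /(G_incident _ _ Gg) /pI pq.
by move=> /(G_incident _ _ Gg).
Qed.

End Interior.

(** * Collineations fixing the origin *)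

Section Stabilizer.
Variable R : realType.
Implicit Types (p q d : Cay R * Cay R) (s : Defs.cpoint R).

Definition direction s d : Prop :=
  match s with
  | Aff _ _ => False
  | Slope u => d.2 = u *o d.1
  | SlopeInf => d.1 = 0
  end.

Lemma direction_line s q d : direction s d ->
  exists l, [/\ incident l s, incident l (Aff q.1 q.2) &
                incident l (Aff (q + d).1 (q + d).2)].
Proof.
case: s => [//|u|] /= dE.
  exists (Line u (q.2 - u *o q.1)); split => //=; first by lin.
  by rewrite dE cmulDr; lin.
by exists (LineV q.1); rewrite /= dE addr0.
Qed.

Lemma line_direction l s p q : incident LineInf s -> incident l s ->
  incident l (Aff q.1 q.2) -> incident l (Aff p.1 p.2) -> direction s (p - q).
Proof.
case: l s => [u v|u|] [x y|w|] //= _.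
  by move=> -> -> ->; rewrite cmulBr; lin.
by move=> _ -> ->; rewrite subrr.
Qed.

Lemma directionB s d1 d2 :
  direction s d1 -> direction s d2 -> direction s (d1 - d2).
Proof.
case: s => [//|u|] /= -> ->; last by rewrite subrr.
by rewrite cmulBr.
Qed.

Lemma directionD s d1 d2 :
  direction s d1 -> direction s d2 -> direction s (d1 + d2).
Proof.
move=> sd1 sd2; rewrite -[d2]opprK -(sub0r d2); do 2?apply: directionB => //.
by rewrite -(subrr d2); apply: directionB.
Qed.

Lemma direction_inter s t d : s <> t -> direction s d -> direction t d -> d = 0.
Proof.
case: d => d1 d2; case: s t => [//|u|] [//|v|] //= st E1 E2.
- have /eqP : (u - v) *o d1 = 0 by rewrite cmulBl -E1 -E2 subrr.
  rewrite cmul_eq0 subr_eq0 => /orP[/eqP uv|/eqP d0]; first by rewrite uv in st.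
  by rewrite E1 d0 cmul0r.
- by rewrite E1 E2 cmul0r.
- by rewrite E2 E1 cmul0r.
Qed.

Lemma direction_ex d : exists s, direction s d.
Proof.
have [d0|d0] := eqVneq d.1 0; first by exists SlopeInf.
by exists (Slope (d.2 *o cinv d.1)); rewrite /= cmulVKr.
Qed.

Variable k : Defs.cpoint R -> Defs.cpoint R.
Hypotheses (Gk : G k) (k0 : k (Aff 0 0) = Aff 0 0).

Definition affine_part p := coords (k (Aff p.1 p.2)).
Local Notation f := affine_part.

(** The polar line of the origin is the line at infinity, and [k] commutes with the polarity. *)
Lemma stab_infinite s : incident LineInf (k s) <-> incident LineInf s.
Proof. by have := G_incident (Aff 0 0) s Gk; rewrite k0 /= eqxx. Qed.

Lemma stab_affine p : k (Aff p.1 p.2) = Aff (f p).1 (f p).2.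
Proof.
rewrite /f; have := (stab_infinite (Aff p.1 p.2)).1.
by case: (k _) => //= [w|] /(_ I).
Qed.

(** Lines go to lines and the line at infinity to itself, so parallel lines stay parallel. *)
Lemma stab_direction s q d : direction s d ->
  direction (k s) (f (q + d) - f q).
Proof.
move=> sd; have [l [ls lq lqd]] := direction_line q sd.
have [[_ kl] _] := Gk.
have [l' l'E] : exists l', k @` on_line l = on_line l'.
  have [] : lines (k @` on_line l) by rewrite -kl; exists (on_line l) => //; exists l.
  by move=> l' _ <-; exists l'.
have kI r : incident l r -> incident l' (k r).
  by rewrite -!on_lineE -l'E => lr; exists r.
apply: (@line_direction l'); rewrite -?stab_affine; try exact: kI.
by apply/stab_infinite; case: s sd {ls}.
Qed.

Lemma affine_part0 : f 0 = 0.
Proof. by rewrite /f k0. Qed.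

(** The defect of additivity is parallel both to [k s] and to [k t], which are distinct since [k] is
    injective. *)
Lemma affine_part_indep s t p q :
  s <> t -> direction s p -> direction t q -> f (p + q) = f p + f q.
Proof.
move=> st sp tq; apply/eqP; rewrite -subr_eq0; apply/eqP.
apply: (@direction_inter (k s) (k t)).
- by have [[/bij_inj kI _] _] := Gk => /kI.
- have -> : f (p + q) - (f p + f q) = (f (q + p) - f q) - (f (0 + p) - f 0).
    by rewrite affine_part0 subr0 add0r (addrC q) -addrA -opprD (addrC (f q)).
  by apply: directionB; apply: stab_direction.
have -> : f (p + q) - (f p + f q) = (f (p + q) - f p) - (f (0 + q) - f 0).
  by rewrite affine_part0 subr0 add0r -addrA -opprD.
by apply: directionB; apply: stab_direction.
Qed.

(* Parallelograms with non parallel sides are preserved; when [p] and [q] are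
   parallel, a third direction [r] is used. *)
Lemma affine_partD p q : f (p + q) = f p + f q.
Proof.
have [[s sp] [t tq]] := (direction_ex p, direction_ex q).
have [st|] := pselect (s = t); last by move/affine_part_indep; apply.
rewrite -st {t st} in tq.
have [[t r] [/= ts tr r0]] : exists tr : Defs.cpoint R * (Cay R * Cay R),
    [/\ tr.1 <> s, direction tr.1 tr.2 & tr.2 <> 0].
  have /eqP c11 := creal1_neq0 R.
  have [->|s0] := pselect (s = Slope 0).
    by exists (SlopeInf, (0, creal 1)); split=> // -[].
  exists (Slope 0, (creal 1, 0)); split; rewrite /= ?cmul0l //.
    by move/esym.
  by case.
have [t' t'r] := direction_ex (q + r).
have t's : t' <> s.
  move=> t's; apply: r0; apply: (direction_inter ts tr).
  by rewrite -[r](addKr q) addrC; apply: directionB; rewrite // -t's.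
apply: (addIr (f r)); rewrite -(affine_part_indep _ (directionD sp tq) tr);
  last exact/nesym.
  rewrite -!addrA (affine_part_indep _ sp t'r); last exact/nesym.
  by rewrite (affine_part_indep _ tq tr) //; exact/nesym.
Qed.

Lemma affine_partMn p n : f (p *+ n) = f p *+ n.
Proof.
by elim: n => [|n IHn]; rewrite ?mulr0n ?affine_part0 // !mulrS affine_partD IHn.
Qed.

Lemma affine_partB p q : f (p - q) = f p - f q.
Proof. by apply/eqP; rewrite eq_sym subr_eq -affine_partD subrK. Qed.

Definition N2 p := cnorm p.1 + cnorm p.2.

Lemma N2_ge0 p : 0 <= N2 p.
Proof. by rewrite addr_ge0 ?cnorm_ge0. Qed.

Lemma N2Z a p : N2 (a *: p) = a ^+ 2 * N2 p.
Proof. by rewrite /N2 /= !cnormZ mulrDr. Qed.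

Lemma affine_part_H2 p : H2 (f p) <-> H2 p.
Proof.
rewrite !H2E.
have [pI Ip] := interiorP (Aff p.1 p.2).
have [qI Iq] := interiorP (Aff (f p).1 (f p).2).
split=> [/Iq {Iq qI}|/Ip {Ip pI}] I1; [apply: pI|apply: qI].
  move=> q /(G_incident _ _ Gk); rewrite stab_affine => /I1 I2.
  by move/(G_incident _ _ Gk).
have [[[k' kK k'K] _] _] := Gk.
rewrite -stab_affine => q; rewrite -[q]k'K => /(G_incident _ _ Gk) /I1 I2.
by move/(G_incident _ _ Gk).
Qed.

(** Additivity gives rational homogeneity, and the unit ball is preserved, so [N2 (f p)] and [N2 p]
    lie below the same squares of positive rationals; these separate the nonnegative reals. *)
Lemma affine_part_N2 p : N2 (f p) = N2 p.
Proof.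
have sep (a b : R) : 0 <= a -> a < b -> exists m n : nat,
    [/\ (0 < m)%N, (0 < n)%N & n%:R ^+ 2 * a < m%:R ^+ 2 < n%:R ^+ 2 * b].
  move=> a0 ab; have sab : Num.sqrt a < Num.sqrt b.
    by rewrite ltr_sqrt // (le_lt_trans a0).
  have [q] := rat_in_itvoo sab; rewrite in_itv /= => /andP[aq qb].
  have q0 : 0 < ratr q :> R by apply: le_lt_trans aq; exact: sqrtr_ge0.
  have mE : numq q = `|numq q|%N.
    by rewrite gez0_abs // numq_ge0 ltW // -(ltr0q R).
  have nE : denq q = `|denq q|%N by rewrite gez0_abs // ltW.
  have n0 : (0 < `|denq q|)%N by rewrite absz_gt0 denq_eq0.
  exists `|numq q|%N, `|denq q|%N; split=> //.
    by rewrite absz_gt0 numq_eq0 gt_eqF // -(ltr0q R).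
  have mnE : `|numq q|%N%:R = `|denq q|%N%:R * ratr q :> R.
    rewrite /ratr {2}mE {2}nE mulrC divfK // pnatr_eq0 -lt0n //.
  rewrite mnE exprMn !ltr_pM2l ?exprn_gt0 ?ltr0n //.
  rewrite -[a]sqr_sqrtr // -[b]sqr_sqrtr ?(ltW (le_lt_trans a0 ab)) //.
  by rewrite !ltr_sqr ?nnegrE ?sqrtr_ge0 ?(ltW q0) // aq.
have unit_ball m n q : (0 < m)%N ->
    (n%:R ^+ 2 * N2 (f q) < m%:R ^+ 2) = (n%:R ^+ 2 * N2 q < m%:R ^+ 2).
  move=> m0; have mR : 0 < m%:R :> R by rewrite ltr0n.
  pose r := (n%:R / m%:R) *: q.
  have frE : f r = (n%:R / m%:R) *: f q.
    have E : r *+ m = q *+ n.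
      by rewrite -(scaler_nat m r) -(scaler_nat n q) scalerA mulrC divfK // gt_eqF.
    have /(congr1 ( *:%R m%:R^-1)) := congr1 f E.
    rewrite !affine_partMn -(scaler_nat m (f r)).
    rewrite -(scaler_nat n (f q)) !scalerA mulVf ?gt_eqF // scale1r => ->.
    by rewrite mulrC.
  have E p' : (n%:R ^+ 2 * N2 p' < m%:R ^+ 2) = (N2 ((n%:R / m%:R) *: p') < 1).
    by rewrite N2Z expr_div_n [in RHS]mulrAC ltr_pdivrMr ?mul1r // exprn_gt0.
  rewrite !E -frE; apply/idP/idP.
    by rewrite -!H2E; apply: (affine_part_H2 r).1.
  by rewrite -!H2E; apply: (affine_part_H2 r).2.
apply/eqP; rewrite eq_le !leNgt; apply/andP; split; apply/negP => h.
  have [m [n [m0 n0 /andP[h1 h2]]]] := sep _ _ (N2_ge0 _) h.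
  by move: h2; rewrite ltNge le_eqVlt unit_ball // h1 orbT.
have [m [n [m0 n0 /andP[h1 h2]]]] := sep _ _ (N2_ge0 _) h.
by move: h2; rewrite ltNge le_eqVlt -unit_ball // h1 orbT.
Qed.
End Stabilizer.

(** * Calculus *)

Section Calculus.
Variable R : realType.
Implicit Types (x y z : Cay R).

Lemma cmul_is_bilinear : bilinear_for
  (GRing.Scale.Law.clone _ _ *:%R _) (GRing.Scale.Law.clone _ _ *:%R _)
  (@cmul R).
Proof.
split=> [y|x] a u v /=; first by rewrite cmulDl cmulZl.
by rewrite cmulDr cmulZr.
Qed.

HB.instance Definition _ :=
  bilinear_isBilinear.Build R (Cay R) (Cay R) (Cay R) _ _ (@cmul R)
    cmul_is_bilinear.

Lemma cconj_is_linear : linear (@cconj R).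
Proof. by move=> a x y; rewrite cconjD cconjZ. Qed.

HB.instance Definition _ :=
  GRing.isLinear.Build R (Cay R) (Cay R) _ (@cconj R) cconj_is_linear.

Lemma differentiable_fst (U W : normedModType R) (p : U * W) :
  differentiable (fun q : U * W => q.1) p.
Proof.
apply: (@linear_differentiable _ (U * W)%type U fst) => q; exact: cvg_fst.
Qed.

Lemma differentiable_snd (U W : normedModType R) (p : U * W) :
  differentiable (fun q : U * W => q.2) p.
Proof.
apply: (@linear_differentiable _ (U * W)%type W snd) => q; exact: cvg_snd.
Qed.

Lemma differentiable_cmul (p : Cay R * Cay R) :
  differentiable (fun q : Cay R * Cay R => q.1 *o q.2) p.
Proof.
have E : (fun q : Cay R * Cay R => q.1 *o q.2) =
    \sum_(i < 8) \sum_(j < 8)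
      (fun q : Cay R * Cay R => (q.1 0 i * q.2 0 j) *: cbase_mul R i j).
  apply/funext => q; rewrite fct_sumE; apply: eq_bigr => i _.
  by rewrite fct_sumE.
rewrite E; do 2![apply: differentiable_sum => ?]; apply: differentiableZl.
apply: (@differentiableM _ _ (fun q : Cay R * Cay R => q.1 0 _)
  (fun q : Cay R * Cay R => q.2 0 _)).
  apply: (@differentiable_comp _ _ _ _ (fun q : Cay R * Cay R => q.1)
    (fun z : Cay R => z 0 _)); last exact: differentiable_coord.
  exact: differentiable_fst.
apply: (@differentiable_comp _ _ _ _ (fun q : Cay R * Cay R => q.2)
  (fun z : Cay R => z 0 _)); last exact: differentiable_coord.
exact: differentiable_snd.
Qed.

Lemma cmul_continuous : continuous (fun q : Cay R * Cay R => q.1 *o q.2).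
Proof. by move=> p; apply/differentiable_continuous/differentiable_cmul. Qed.

Lemma differentiable_cconj x : differentiable (@cconj R) x.
Proof.
have -> : @cconj R = (fun x => (2 * x 0 (inord 0)) *: cbase R 0) - id.
  by apply/funext => y; rewrite cconjE.
apply: differentiableB => //; apply: differentiableZl.
exact/differentiableZ/differentiable_coord.
Qed.

Lemma cconj_continuous : continuous (@cconj R).
Proof. by move=> x; apply/differentiable_continuous/differentiable_cconj. Qed.

Section Maps.
Variable V : normedModType R.
Implicit Types (f g df dg : V -> Cay R).

Lemma is_diff_cmul f g df dg (x : V) : is_diff x f df -> is_diff x g dg ->
  is_diff x (fun t => f t *o g t) (fun h => f x *o dg h + df h *o g x).
Proof.
move=> dfx dgx.
have dm : is_diff (f x, g x) (fun q : Cay R * Cay R => q.1 *o q.2)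
    (fun q => f x *o q.2 + q.1 *o g x).
  apply: DiffDef; first exact: differentiable_cmul.
  by rewrite (@diff_bilin _ _ _ _ (@cmul R)) //; exact: cmul_continuous.
exact: (@is_diff_comp _ _ _ _ (fun t => (f t, g t)) (fun h => (df h, dg h))).
Qed.

Lemma is_diff_cconj f df (x : V) :
  is_diff x f df -> is_diff x (fun t => cconj (f t)) (fun h => cconj (df h)).
Proof.
move=> dfx; apply: (@is_diff_comp _ _ _ _ f df (@cconj R) (@cconj R)).
apply: DiffDef.
  exact/linear_differentiable/cconj_continuous.
by rewrite diff_lin //; exact: cconj_continuous.
Qed.

Lemma differentiable_cinv (y : Cay R) : y != 0 -> differentiable (@cinv R) y.
Proof.
move=> y0.
have cE : @cinv R =
    (fun y => creal ((y *o cconj y) 0 (inord 0))^-1 *o cconj y).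
  by apply/funext => z; rewrite cmul_conj cmul_reall -/(crd _ _) crdE.
rewrite cE; apply: (@differentiable_comp _ _ _ _
    (fun y : Cay R => (creal ((y *o cconj y) 0 (inord 0))^-1, cconj y))
    (fun q : Cay R * Cay R => q.1 *o q.2)); last first.
  exact: differentiable_cmul.
apply: differentiable_pair; last exact: differentiable_cconj.
apply: differentiableZl; apply: differentiableV; last first.
  by rewrite cmul_conj -/(crd _ _) crdE cnorm_eq0.
apply: (@differentiable_comp _ _ _ _ (fun y : Cay R => y *o cconj y)
    (fun z : Cay R => z 0 _)); last first.
  exact: differentiable_coord.
apply: (@differentiable_comp _ _ _ _ (fun y : Cay R => (y, cconj y))
    (fun q : Cay R * Cay R => q.1 *o q.2)); last first.
  exact: differentiable_cmul.
by apply: differentiable_pair => //; exact: differentiable_cconj.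
Qed.

(* Differentiate [(y (cconj y)) (cinv y) = cconj y]. *)
Lemma is_diff_cinv f df (x : V) : is_diff x f df -> f x != 0 ->
  is_diff x (fun t => cinv (f t))
    (fun h => - ((cinv (f x) *o df h) *o cinv (f x))).
Proof.
move=> dfx f0.
have dcx : differentiable (fun t => cinv (f t)) x.
  exact: differentiable_comp (differentiable_cinv f0).
apply: DiffDef => //; apply/funext => h.
(* As [cinv 0 = 0], this identity holds at every [t] and can be differentiated without restricting
   to a neighbourhood where [f] does not vanish. *)
have E : (fun t => (f t *o cconj (f t)) *o cinv (f t)) = (fun t => cconj (f t)).
  apply/funext => t; rewrite cmul_conj cmul_reall.
  have [->|t0] := eqVneq (f t) 0; first by rewrite cinv0 scaler0 cconj0.
  by rewrite scalerA mulfV ?scale1r // cnorm_eq0.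
have d2 : is_diff x (fun t => cinv (f t)) ('d (fun t => cinv (f t)) x).
  exact: DiffDef.
have d1 := is_diff_cmul (is_diff_cmul dfx (is_diff_cconj dfx)) d2.
have d3 : is_diff x (fun t => f t *o cconj (f t) *o cinv (f t))
    (fun h => cconj (df h)) by rewrite E; exact: is_diff_cconj.
have := congr1 (fun F : V -> Cay R => F h)
  (etrans (esym (diff_val (is_diff_def := d1)))
     (diff_val (is_diff_def := d3))).
cbv beta.
set D := 'd _ _ _; rewrite cmul_conj cmul_reall => /(canRL (addrK _)) DE.
have N0 : cnorm (f x) != 0 by rewrite cnorm_eq0.
have : cnorm (f x) *: D = cnorm (f x) *: - ((cinv (f x) *o df h) *o cinv (f x)).
  rewrite DE scalerN -cmulZl -cmulZl {3}/cinv scalerA mulfV // scale1r.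
  rewrite -[X in X - _](cmulKr _ f0) -cmulBl -cmulNl; congr (_ *o _).
  by move: (f x) (df h) => y d; oct.
by move=> /(scalerI N0).
Qed.
End Maps.
End Calculus.

(** * Siegel coordinates *)

Section Siegel.
Variable R : realType.
Implicit Types (x y z : Cay R) (p q v w : Cay R * Cay R).

Definition siegel p := (cinv (creal 1 - p.1), p.2 *o cinv (creal 1 - p.1)).
Definition unsiegel w := (creal 1 - cinv w.1, w.2 *o cinv w.1).

(** The image of [H2] under [siegel]: multiply [1 - |x1|^2 - |x2|^2 > 0] by [|w1|^2], where
    [w1 = (1 - x1)^-1]. *)
Definition siegel_dom w : Prop := cnorm w.2 < 2 * crd w.1 0 - 1.

Lemma siegel_dom_neq0 w : siegel_dom w -> w.1 != 0.
Proof.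
rewrite /siegel_dom; apply: contraTneq => ->; rewrite crd0 mulr0 sub0r -leNgt.
by apply: le_trans (cnorm_ge0 _); rewrite lerN10.
Qed.

Lemma H2_neq1 p : H2 p -> creal 1 - p.1 != 0.
Proof.
rewrite H2E subr_eq0; apply: contraTneq => <-.
by rewrite cnorm_real expr1n -leNgt lerDl cnorm_ge0.
Qed.

Lemma siegelK p : H2 p -> unsiegel (siegel p) = p.
Proof.
move=> /H2_neq1 p1; rewrite /unsiegel /siegel /= cinvK subKr cmulVKr //.
by case: p {p1}.
Qed.

Lemma unsiegelK w : w.1 != 0 -> siegel (unsiegel w) = w.
Proof.
move=> w1; rewrite /unsiegel /siegel /= subKr cinvK cmulVKr //.
by case: w {w1}.
Qed.

Lemma crd_cinv0 x : crd (cinv x) 0 = (cnorm x)^-1 * crd x 0.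
Proof. by rewrite /cinv !crdE. Qed.

Lemma H2_unsiegel w : siegel_dom w -> H2 (unsiegel w).
Proof.
move=> wD; have w0 := siegel_dom_neq0 wD; rewrite H2E /=.
have N0 : 0 < cnorm w.1 by rewrite cnorm_gt0.
rewrite -cnormN opprB cnorm_subr cnorm_mul cnorm_inv crd_cinv0.
rewrite -subr_gt0; have -> : 1 - ((cnorm w.1)^-1 -
    2 * 1 * ((cnorm w.1)^-1 * crd w.1 0) + 1 ^+ 2 + cnorm w.2 / cnorm w.1) =
    (2 * crd w.1 0 - 1 - cnorm w.2) / cnorm w.1.
  by field; rewrite gt_eqF.
by rewrite divr_gt0 // subr_gt0.
Qed.

Lemma siegel_dom_siegel p : H2 p -> siegel_dom (siegel p).
Proof.
move=> pH; have := H2_neq1 pH; move: pH.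
rewrite H2E /siegel_dom /siegel /=; set b := creal 1 - p.1.
have -> : p.1 = creal 1 - b by rewrite subKr.
rewrite -[cnorm (creal 1 - b)]cnormN opprB cnorm_subr => pH b0.
have N0 : 0 < cnorm b by rewrite cnorm_gt0.
rewrite cnorm_mul cnorm_inv crd_cinv0 ltr_pdivrMr // mulrBl mul1r.
have -> : 2 * ((cnorm b)^-1 * crd b 0) * cnorm b = 2 * crd b 0.
  by field; rewrite gt_eqF.
lra.
Qed.

(* With [r = e^t], the action of [a_t] in Siegel coordinates. *)
Definition dil (r : R) w :=
  (r ^+ 2 *: (w.1 - creal 2^-1) + creal 2^-1, r *: w.2).

Lemma dilM r s w : dil r (dil s w) = dil (r * s) w.
Proof. by rewrite /dil /= addrK !scalerA exprMn. Qed.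

Lemma dil1 w : dil 1 w = w.
Proof. by case: w => a b; rewrite /dil /= expr1n !scale1r subrK. Qed.

Lemma siegel_dom_dil r w : 0 < r -> siegel_dom w -> siegel_dom (dil r w).
Proof.
move=> r0; rewrite /siegel_dom /= cnormZ !crdE => wD.
(* The centre [1/2] is the Siegel coordinate of the boundary point [(-1, 0)], fixed by every [a_t];
   so [2 Re w1 - 1] is just multiplied by [r^2]. *)
have -> : 2 * (r ^+ 2 * (crd w.1 0 - 2^-1) + 2^-1) - 1 =
  r ^+ 2 * (2 * crd w.1 0 - 1) by field.
by rewrite ltr_pM2l // exprn_gt0.
Qed.

(** Transfers the product, inverse and chain rules for [is_diff] to curves. *)
Lemma derive_diffP (W : normedModType R) (f : R -> W) (t : R) (v : W) :
  is_derive t 1 f v <-> is_diff t f (fun h => h *: v).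
Proof.
split=> [df|df].
  have /derivable1_diffP dft := @ex_derive _ _ _ _ _ _ _ df.
  apply: DiffDef => //; rewrite diff1E // derive1E.
  by rewrite (derive_val (is_derive := df)).
have dft := ex_diff (is_diff_def := df).
apply: DeriveDef; first exact/derivable1_diffP.
by rewrite deriveE // (diff_val (is_diff_def := df)) scale1r.
Qed.

Lemma is_derive_diff_comp (U W : normedModType R) (f : R -> U) (g dg : U -> W)
    (t : R) (v : U) :
  is_derive t 1 f v -> is_diff (f t) g dg -> is_derive t 1 (g \o f) (dg v).
Proof.
move=> /derive_diffP df dgf; apply/derive_diffP.
have [dft _] := df; have [dgft E] := dgf.
apply: DiffDef; first exact: differentiable_comp.
rewrite diff_comp //; apply/funext => h /=; rewrite -E.
by rewrite (diff_val (is_diff_def := df)) linearZ.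
Qed.
End Siegel.

(** * Derivatives of curves and the vector field generating [A] *)

Section Curves.
Variable R : realType.
Implicit Types (f g : R -> Cay R) (t : R) (a b : Cay R).

Lemma curve_mul f g t a b : is_derive t 1 f a -> is_derive t 1 g b ->
  is_derive t 1 (fun s => f s *o g s) (a *o g t + f t *o b).
Proof.
move=> /derive_diffP df /derive_diffP dg; apply/derive_diffP.
apply: (is_diff_eq (is_diff_cmul df dg)); apply/funext => h /=.
by rewrite cmulZl cmulZr -scalerDr addrC.
Qed.

Lemma curve_inv f t a : is_derive t 1 f a -> f t != 0 ->
  is_derive t 1 (fun s => cinv (f s)) (- (cinv (f t) *o a *o cinv (f t))).
Proof.
move=> /derive_diffP df f0; apply/derive_diffP.
apply: (is_diff_eq (is_diff_cinv df f0)); apply/funext => h /=.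
by rewrite (cmulZr h) (cmulZl h) scalerN.
Qed.

Lemma curve_pair (U W : normedModType R) (f1 : R -> U) (f2 : R -> W) t
    (u : U) (w : W) : is_derive t 1 f1 u -> is_derive t 1 f2 w ->
  is_derive t 1 (fun s => (f1 s, f2 s)) (u, w).
Proof.
move=> /derive_diffP df /derive_diffP dg; apply/derive_diffP.
Qed.

Lemma is_diff_fst (U W : normedModType R) (p : U * W) :
  is_diff p (fun q => q.1) (fun q => q.1).
Proof.
apply: DiffDef; first exact: differentiable_fst.
by apply: (@diff_lin _ _ _ fst) => q; exact: cvg_fst.
Qed.

Lemma is_diff_snd (U W : normedModType R) (p : U * W) :
  is_diff p (fun q => q.2) (fun q => q.2).
Proof.
apply: DiffDef; first exact: differentiable_snd.
by apply: (@diff_lin _ _ _ snd) => q; exact: cvg_snd.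
Qed.

Lemma curve_fst (U W : normedModType R) (f : R -> U * W) t (v : U * W) :
  is_derive t 1 f v -> is_derive t 1 (fun s => (f s).1) v.1.
Proof. by move=> /is_derive_diff_comp; apply; exact: is_diff_fst. Qed.

Lemma curve_snd (U W : normedModType R) (f : R -> U * W) t (v : U * W) :
  is_derive t 1 f v -> is_derive t 1 (fun s => (f s).2) v.2.
Proof. by move=> /is_derive_diff_comp; apply; exact: is_diff_snd. Qed.

Lemma curve_scale (W : normedModType R) (k : R -> R) t (a : R) (w : W) :
  is_derive t 1 k a -> is_derive t 1 (fun s => k s *: w) (a *: w).
Proof.
move=> dk; apply: (@is_derive_diff_comp _ R W k ( *:%R^~ w) ( *:%R^~ w)) => //.
Qed.

Lemma curve_crd f t a i :
  is_derive t 1 f a -> is_derive t 1 (fun s => f s 0 i) (a 0 i).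
Proof.
move=> df; pose l (x : Cay R) := x 0 i.
have ll : linear l by move=> c x y; rewrite /l !mxE.
pose L : {linear Cay R -> R} := HB.pack l (GRing.isLinear.Build _ _ _ _ l ll).
have Lc : continuous L by exact: coord_continuous.
apply: (@is_derive_diff_comp _ (Cay R) R f L L _ _ df).
by apply: DiffDef; [exact: linear_differentiable|rewrite diff_lin].
Qed.

(** The product of [f] with [expR (- c * t)] has zero derivative; this is used coordinate by
    coordinate, for real functions. *)
Lemma curve_exp f (c : R) : (forall t, is_derive t 1 f (c *: f t)) ->
  forall t, f t = expR (c * t) *: f 0.
Proof.
move=> df t; suff E : expR (- c * t) *: f t = f 0.
  by rewrite -E scalerA -expRD mulNr addrN expR0 scale1r.
have dexp (s : R) : is_derive s 1 (fun s => expR (- c * s)) (- c * expR (- c * s)).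
  have d1 : is_derive s 1 (fun s => - c * s) (- c).
    by apply: is_derive_eq; rewrite /GRing.scale /= mulr1.
  apply: (is_derive_eq (is_derive1_comp (is_derive_expR (- c * s)) d1)).
  by rewrite mulrC.
have dF (s : R) (i : 'I_8) : is_derive s 1 (fun s => expR (- c * s) * f s 0 i) 0.
  apply: (is_derive_eq (is_deriveM (dexp s) (curve_crd i (df s)))).
  by rewrite !mxE /GRing.scale /=; ring.
apply/rowP => i; rewrite !mxE.
have := @is_derive_0_is_cst R (fun s => expR (- c * s) * f s 0 i) t 0 (dF^~ i).
by rewrite mulr0 expR0 mul1r.
Qed.

Definition XAf (p : Cay R * Cay R) := (creal 1 - p.1 *o p.1, - (p.2 *o p.1)).

(** At [t = 0] the denominator of [a_t] is [1], so the quotient can be differentiated at every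
    [p]. *)
Lemma XAE : @XA R = XAf.
Proof.
apply/funext => p; rewrite /XA derive1E; apply: derive_val.
have e1 := is_derive_expR (0 : R).
have e2 : is_derive (0 : R) 1 (fun t => expR (- t)) (- 1).
  have := is_derive1_comp (is_derive_expR (- 0 : R))
    (is_deriveNid (0 : R) (1 : R)).
  by rewrite oppr0 expR0 mul1r.
have dc : is_derive (0 : R) 1 (@cosh R) 0.
  have -> : @cosh R = 2^-1 *: (expR + (fun t => expR (- t))).
    by apply/funext => t; rewrite /cosh mulrC.
  apply: (is_derive_eq (is_deriveZ _ (is_deriveD e1 e2))).
  by rewrite expR0 subrr scaler0.
have ds : is_derive (0 : R) 1 (@sinh R) 1.
  have -> : @sinh R = 2^-1 *: (expR - (fun t => expR (- t))).
    by apply/funext => t; rewrite /sinh mulrC.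
  apply: (is_derive_eq (is_deriveZ _ (is_deriveB e1 e2))).
  by rewrite expR0 /GRing.scale /=; field.
have c0 : cosh 0 = 1 :> R.
  by rewrite /cosh oppr0 expR0; field.
have s0 : sinh 0 = 0 :> R.
  by rewrite /sinh oppr0 subrr mul0r.
have dn : is_derive (0 : R) 1 (fun t => sinh t *: p.1 + creal (cosh t)) p.1.
  apply: (is_derive_eq (is_deriveD (curve_scale p.1 ds)
    (curve_scale (cbase R 0) dc))).
  by rewrite scale1r scale0r addr0.
have dm : is_derive (0 : R) 1 (fun t => cosh t *: p.1 + creal (sinh t))
    (creal 1).
  apply: (is_derive_eq (is_deriveD (curve_scale p.1 dc)
    (curve_scale (cbase R 0) ds))).
  by rewrite scale0r add0r.
have n0 : sinh 0 *: p.1 + creal (cosh 0) = creal 1 by rewrite s0 scale0r add0r c0.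
have m0 : cosh 0 *: p.1 + creal (sinh 0) = p.1.
  by rewrite s0 c0 scale1r /creal scale0r addr0.
have c11 := creal1_neq0 R.
have dq : is_derive (0 : R) 1
    (fun t => cinv (sinh t *: p.1 + creal (cosh t))) (- p.1).
  apply: (is_derive_eq (curve_inv dn _)); rewrite n0 //.
  by rewrite cinv_real invr1 cmul1l cmul1r.
apply: (is_derive_eq (curve_pair (curve_mul dm dq)
  (curve_mul (is_derive_cst p.2 _ _) dq))).
rewrite m0 n0 cinv_real invr1 /XAf.
by rewrite cmul1r cmulNr cmul0l add0r cmulNr.
Qed.
End Curves.

(** * Root spaces *)

Section Homogeneity.
Variable R : realType.
Implicit Types (a t : R) (p v w : Cay R * Cay R).

Lemma is_diff_XAf p : is_diff p (@XAf R)
  (fun v => (- (p.1 *o v.1 + v.1 *o p.1), - (p.2 *o v.1 + v.2 *o p.1))).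
Proof.
have d1 := is_diff_fst p; have d2 := is_diff_snd p.
have d3 := is_diffB (is_diff_cst (creal 1) p) (is_diff_cmul d1 d1).
have d4 := is_diffN (is_diff_cmul d2 d1).
apply: (is_diff_eq (is_diff_pair d3 d4)).
by apply/funext => v; congr pair; apply: sub0r.
Qed.

(* The differential of [siegel] at [unsiegel w]. *)
Definition dsiegel w v :=
  (w.1 *o v.1 *o w.1, (v.2 + w.2 *o v.1) *o w.1).

(** With [b = 1 - p.1], the Moufang identity turns [p.2 (b^-1 v1 b^-1)] into [((p.2 b^-1) v1) b^-1],
    which depends on [p] through its Siegel coordinates only. *)
Lemma is_diff_siegel p : creal 1 - p.1 != 0 ->
  is_diff p (@siegel R) (dsiegel (siegel p)).
Proof.
move=> p1; have d1 := is_diff_fst p; have d2 := is_diff_snd p.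
have d3 : is_diff p (fun p => creal 1 - p.1) (fun v => - v.1).
  apply: (is_diff_eq (is_diffB (is_diff_cst (creal 1) p) d1)).
  by apply/funext => v; apply: sub0r.
have d4 := is_diff_cinv d3 p1.
apply: (is_diff_eq (is_diff_pair d4 (is_diff_cmul d2 d4))).
apply/funext => v; rewrite /dsiegel /siegel /=; congr pair.
  by rewrite cmulNr cmulNl opprK.
by rewrite !cmulNr cmulNl !cmulNr opprK moufang_right cmulDl addrC.
Qed.

Lemma cmul_altr_polar (x y z : Cay R) :
  x *o (y *o z + z *o y) = (x *o y) *o z + (x *o z) *o y.
Proof.
have := cmul_altr x (y + z).
rewrite !cmulDr !cmulDl !cmulDr !cmul_altr => /eqP; rewrite -subr_eq0 => E.
apply/eqP; rewrite -subr_eq0 -oppr_eq0; move: E; congr (_ == 0); lin.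
Qed.

(* [v1'] and [v2'] are the derivatives, along the flow of [XAf], of the
   components of a vector field of weight [a], at the point with Siegel
   coordinates [(z, e)]. *)
Section Euler.
Variables (z e v1 v2 : Cay R) (a : R).
Hypothesis z0 : z != 0.
Let p1 := creal 1 - cinv z.
Let p2 := e *o cinv z.
Let v1' := - (p1 *o v1 + v1 *o p1) - a *: v1.
Let v2' := - (p2 *o v1 + v2 *o p1) - a *: v2.

(** The left side is the derivative of [z v1 z] along a dilation orbit, where [z' = 2z - 1]; so this
    component is homogeneous of degree [2 - a]. *)
Lemma euler1 : ((2 *: z - creal 1) *o v1 + z *o v1') *o z +
  (z *o v1) *o (2 *: z - creal 1) = (2 - a) *: (z *o v1 *o z).
Proof.
have E1 : z *o (cinv z *o v1) = v1 by exact: cmulVKl.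
have E2 : z *o (v1 *o cinv z) *o z = z *o v1 by rewrite cmul_flex cmulVKr.
rewrite /v1' /p1 !(cmulBl, cmulBr, cmulNr, cmulNl, cmulDr, cmulDl, cmul1l, cmul1r).
rewrite !(cmulZl 2) !(cmulZr a) !(cmulZl a) !(cmulZr 2) E1 E2.
lin.
Qed.

(** The same for [(v2 + e v1) z], with [e' = e]. *)
Lemma euler2 : (v2' + (e *o v1 + e *o v1')) *o z +
  (v2 + e *o v1) *o (2 *: z - creal 1) = (1 - a) *: ((v2 + e *o v1) *o z).
Proof.
have E1 : (v2 *o cinv z) *o z = v2 by exact: cmulVKr.
(* The terms [(e (z^-1 v1)) z] and [(e (v1 z^-1)) z] are not reassociated one by one; polarized
   right alternativity gives their sum, and this suffices for the cancellation. *)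
have E2 : ((e *o cinv z) *o v1) *o z + e *o v1 =
   e *o (cinv z *o v1 + v1 *o cinv z) *o z.
  by rewrite cmul_altr_polar cmulDl [X in _ = _ + X]cmulVKr.
move: E2; rewrite /v2' /v1' /p1 /p2.
rewrite !(cmulBl, cmulBr, cmulNr, cmulNl, cmulDr, cmulDl, cmul1l, cmul1r).
rewrite !(cmulZr a) !(cmulZl a) !(cmulZr 2) E1 => E2.
set X1 := (_ *o (cinv z *o v1) *o z) in E2 *.
set X2 := (_ *o (v1 *o cinv z) *o z) in E2 *.
have -> : X2 = e *o cinv z *o v1 *o z + e *o v1 - X1 by rewrite E2; lin.
lin.
Qed.
End Euler.
End Homogeneity.

(** * Homogeneity of root vector fields in Siegel coordinates *)

Section Flow.
Variable R : realType.
Implicit Types (a t : R) (p v w : Cay R * Cay R).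
Implicit Type V : Cay R * Cay R -> Cay R * Cay R.

(** The push-forward of [V] by [siegel]. *)
Definition siegel_field V w := dsiegel w (V (unsiegel w)).

Lemma dil_curve1 w t : is_derive t 1 (fun s => (dil (expR s) w).1)
  (2 *: (dil (expR t) w).1 - creal 1).
Proof.
have e1 := is_derive_expR t; set z := w.1 - creal 2^-1.
have e2 : is_derive t 1 (fun s => expR s ^+ 2) (2 * expR t ^+ 2).
  apply: (is_derive_eq (is_deriveM e1 e1)).
  by rewrite /GRing.scale /= expr2; ring.
apply: (is_derive_eq (is_deriveD (curve_scale z e2)
  (is_derive_cst (creal 2^-1 : Cay R) _ _))).
rewrite /dil /= -/z; move: z => z.
by rewrite scalerDr crealZ mulfV // addr0 addrK scalerA.
Qed.

(** Dilation orbits are the integral curves of the generator of [A]; along them the condition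
    [[X, V] = a V] becomes an ordinary differential equation. *)
Lemma unsiegel_dil_curve w t : siegel_dom w ->
  is_derive t 1 (fun s => unsiegel (dil (expR s) w))
    (XAf (unsiegel (dil (expR t) w))).
Proof.
move=> wD; have e1 := is_derive_expR t.
have d2 : is_derive t 1 (fun s => (dil (expR s) w).2) (dil (expR t) w).2.
  exact: curve_scale.
have d1 := dil_curve1 w t.
have W0 : (dil (expR t) w).1 != 0.
  by apply: siegel_dom_neq0; apply: siegel_dom_dil => //; exact: expR_gt0.
have d3 := curve_inv d1 W0.
apply: (is_derive_eq (curve_pair
  (is_deriveB (is_derive_cst (creal 1 : Cay R) _ _) d3) (curve_mul d2 d3))).
move: (dil (expR t) w) W0 => [x y] /= x0; rewrite /XAf /unsiegel /=.
have E : cinv x *o (2 *: x - creal 1) *o cinv x = 2 *: cinv x - cinv x *o cinv x.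
  by rewrite cmulBr (cmulZr 2) cmulVx // cmul1r cmulBl (cmulZl 2) cmul1l.
rewrite E; congr pair.
  by rewrite !(cmulBl, cmulBr) !cmul1r cmul1l; lin.
by rewrite cmulNr !cmulBr !cmul1r (cmulZr 2) -cmul_altr; lin.
Qed.

Lemma root_space_flow a V p : root_space a V -> H2 p ->
  'd V p (XAf p) = (- (p.1 *o (V p).1 + (V p).1 *o p.1) - a *: (V p).1,
                    - (p.2 *o (V p).1 + (V p).2 *o p.1) - a *: (V p).2).
Proof.
move=> [_ Va] pH.
have solve (U : zmodType) (A B C D : U) : A - B = C -> A = D -> B = D - C.
  by move=> <- ->; rewrite subKr.
have E := Va p pH; rewrite /ad XAE in E.
exact: (solve _ _ _ _ _ E (congr1 (@^~ (V p))
  (diff_val (is_diff_def := is_diff_XAf p)))).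
Qed.

(** By [euler1] and [euler2] each component satisfies a linear equation with constant real
    coefficient along the orbit, solved by [curve_exp]. *)
Lemma siegel_field_dil a V w t : root_space a V -> siegel_dom w ->
  siegel_field V (dil (expR t) w) =
  (expR ((2 - a) * t) *: (siegel_field V w).1,
   expR ((1 - a) * t) *: (siegel_field V w).2).
Proof.
move=> Va wD; pose F s := siegel_field V (dil (expR s) w).
have dF (s : R) : is_derive s 1 F ((2 - a) *: (F s).1, (1 - a) *: (F s).2).
  have e1 := is_derive_expR s.
  set q := unsiegel (dil (expR s) w).
  have WD : siegel_dom (dil (expR s) w) by apply: siegel_dom_dil; rewrite ?expR_gt0.
  have qH : H2 q by exact: H2_unsiegel.
  have d2 : is_derive s 1 (fun s => (dil (expR s) w).2) (dil (expR s) w).2.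
    exact: curve_scale.
  have d1 := dil_curve1 w s.
  have [[Vdiff _] _] := Va.
  have dV : is_diff q V ('d V q) by apply: DiffDef => //; exact: Vdiff.
  have dq := is_derive_diff_comp (unsiegel_dil_curve s wD) dV.
  rewrite (root_space_flow Va qH) in dq.
  have dV1 := curve_fst dq; have dV2 := curve_snd dq.
  have dF1 := curve_mul (curve_mul d1 dV1) d1.
  have dF2 := curve_mul (is_deriveD dV2 (curve_mul d2 dV1)) d1.
  apply: (is_derive_eq (curve_pair dF1 dF2)).
  have z0 := siegel_dom_neq0 WD.
  exact: (congr2 pair (euler1 (V q).1 a z0)
    (euler2 (dil (expR s) w).2 (V q).1 (V q).2 a z0)).
have F0 : F 0 = siegel_field V w by rewrite /F expR0 dil1.
have E1 : (F t).1 = _ := curve_exp (fun s => curve_fst (dF s)) t.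
have E2 : (F t).2 = _ := curve_exp (fun s => curve_snd (dF s)) t.
by rewrite -/(F t) [F t]surjective_pairing E1 E2 F0.
Qed.
End Flow.

(** * Contraction *)

Section Contraction.
Variable R : realType.
Implicit Types (a t : R) (p q v w : Cay R * Cay R).
Implicit Type V : Cay R * Cay R -> Cay R * Cay R.

Lemma cay2_norm_le v a : 0 <= a -> (forall i, `|v.1 0 i| <= a) ->
  (forall i, `|v.2 0 i| <= a) -> `|v| <= a.
Proof.
move=> a0 v1 v2; rewrite prod_normE ge_max; apply/andP; split.
all: rewrite /Num.Def.normr /= mx_normrE; apply/bigmax_leP; split=> //= -[i j] _.
all: by rewrite /= ord1.
Qed.

(** The mean value theorem in each coordinate; no constant is lost because the norm is the sup
    norm. *)
Lemma path_bound (P D : R -> Cay R * Cay R) t C : 0 <= t -> 0 <= C ->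
  (forall s : R, is_derive s 1 P (D s)) ->
  (forall s, 0 < s < t -> `|D s| <= C) -> `|P t - P 0| <= C * t.
Proof.
move=> t0 C0 dP DC.
have coord (l : Cay R * Cay R -> R) :
    (forall s : R, is_derive s 1 (l \o P) (l (D s))) ->
    (forall v, `|l v| <= `|v|) -> `|l (P t) - l (P 0)| <= C * t.
  move=> dl l1; have [<-|t_neq0] := eqVneq 0 t.
    by rewrite subrr normr0 mulr0.
  have t_gt0 : 0 < t by rewrite lt_def eq_sym t_neq0.
  have dlt x : x \in `]0, t[ -> is_derive x 1 (l \o P) (l (D x)) by [].
  have lc : {within `[0, t], continuous (l \o P)}.
    apply: derivable_within_continuous => x _.
    exact: (ex_derive (is_derive := dl x)).
  have [c] := MVT t_gt0 dlt lc.
  rewrite in_itv /= subr0 => c0t ->; rewrite normrM (ger0_norm t0).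
  by rewrite ler_wpM2r // (le_trans (l1 _)) ?DC.
have mx_le (x : Cay R) i : `|x 0 i| <= `|x|.
  rewrite [leRHS]/Num.Def.normr /= mx_normrE.
  by apply: le_trans (le_bigmax _ _ (0, i)).
apply: cay2_norm_le => [|i|i]; first by rewrite mulr_ge0.
- have := coord (fun v => v.1 0 i); rewrite /= !mxE; apply=> [s|v].
    exact/curve_crd/curve_fst.
  by rewrite (le_trans (mx_le _ _)) // prod_normE le_max lexx.
have := coord (fun v => v.2 0 i); rewrite /= !mxE; apply=> [s|v].
  exact/curve_crd/curve_snd.
by rewrite (le_trans (mx_le _ _)) // prod_normE le_max lexx orbT.
Qed.

(* Up to the first exit time from a ball around [w], the velocity is [O(r)], so
   that [P] cannot reach the boundary of the ball before time [1]. *)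
Lemma trapped (A B : Cay R * Cay R -> Cay R * Cay R) w (e : R) :
  A x @[x --> w] --> A w -> B x @[x --> w] --> B w -> 0 < e ->
  exists2 r0 : R, 0 < r0 & forall r P, 0 < r < r0 -> P 0 = w ->
    (forall s : R, is_derive s 1 P (r *: A (P s) + r ^+ 2 *: B (P s))) ->
    `|P 1 - w| < e.
Proof.
move=> Ac Bc e0; pose C := `|A w| + `|B w| + 1.
have C0 : 0 < C by rewrite ltr_wpDl // addr_ge0.
have AC : `|A w| < C by rewrite /C -addrA ltrDl ltr_wpDl.
have BC : `|B w| < C by rewrite /C -addrAC ltrDr ltr_wpDl.
have : \forall x \near w, `|A x| <= C /\ `|B x| <= C.
  near=> x; split; near: x.
    exact: cvgr_norm_le Ac _ AC.
  exact: cvgr_norm_le Bc _ BC.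
move=> /nbhs_ballP [d /= d0 dAB].
pose m := Num.min d e; have m0 : 0 < m by rewrite lt_min d0.
(* For [r < 1] the speed inside the ball is at most [2 r C], and [r < m / (2 C)] keeps the distance
   covered in unit time below [m]. *)
exists (Num.min 1 (m / (2 * C))).
  by rewrite lt_min ltr01 /= divr_gt0 // mulr_gt0.
move=> r P /andP[r0]; rewrite lt_min => /andP[r1].
rewrite ltr_pdivlMr ?mulr_gt0 // => rm P0 dP.
have Dle s : `|P s - w| < m -> `|r *: A (P s) + r ^+ 2 *: B (P s)| <= r * (2 * C).
  rewrite lt_min => /andP[Pd _].
  have [] : `|A (P s)| <= C /\ `|B (P s)| <= C.
    by apply: dAB; rewrite /= -ball_normE /= distrC.
  move=> hA hB; rewrite (le_trans (ler_normD _ _)) // !normrZ.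
  rewrite (gtr0_norm r0).
  have : r * `|A (P s)| <= r * C by rewrite ler_wpM2l // ltW.
  have : r * r * `|B (P s)| <= r * C.
    rewrite -mulrA ler_wpM2l ?(ltW r0) // -[leRHS]mul1r.
    by rewrite ler_pM ?(ltW r0) ?(ltW r1).
  lra.
have Pc : continuous P.
  move=> s; apply/differentiable_continuous/derivable1_diffP.
  exact: (ex_derive (is_derive := dP s)).
have bound s : 0 <= s <= 1 -> (forall s', 0 < s' < s -> `|P s' - w| < m) ->
    `|P s - w| < m.
  move=> /andP[s0 s1] sm.
  have := path_bound s0 _ dP (fun s' h => Dle _ (sm _ h)).
  rewrite P0 => -/(_ _)/le_lt_trans; apply; first by rewrite ltW // !mulr_gt0.
  rewrite (le_lt_trans _ rm) // -[leRHS]mulr1 ler_wpM2l //.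
  by rewrite ltW // !mulr_gt0.
suff : `|P 1 - w| < m by rewrite lt_min => /andP[].
apply: contrapT => /negP; rewrite -leNgt => P1.
(* [S] collects the times spent outside the open ball. The estimate at [inf S] is strict, hence by
   continuity it persists just after [inf S], against [inf_adherent]. *)
pose S := [set s | 0 <= s <= 1 /\ m <= `|P s - w|].
have S1 : S 1 by split; rewrite ?ler01 ?lexx.
have hS : has_inf S by split; [exists 1|exists 0 => s [/andP[]]].
have iS : 0 <= inf S <= 1.
  apply/andP; split; first by apply: lb_le_inf; [exists 1|move=> s [/andP[]]].
  by apply: ge_inf => //; exact: hS.2.
have : `|P (inf S) - w| < m.
  apply: bound => // s /andP[s0 s1]; rewrite ltNge; apply/negP => ms.
  move: (s1); rewrite ltNge => /negP; apply; apply: ge_inf; first exact: hS.2.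
  by split=> //; rewrite (ltW s0) /= (le_trans (ltW s1)) //; case/andP: iS.
move=> im.
have : \forall s \near inf S, `|P s - w| < m.
  have := @cvgr_norm_lt _ _ _ (nbhs (inf S)) _ (fun s => P s - w) (P (inf S) - w).
  by apply=> //; apply: cvgB; [exact: Pc|exact: cvg_cst].
move=> /nbhs_ballP [c /= c0 cS].
have [s [s01 ms] sc] := inf_adherent c0 hS.
have : `|P s - w| < m.
  apply: cS; rewrite /ball /= ltr_distlC.
  have : inf S <= s by apply: ge_inf; [exact: hS.2|split].
  lra.
by rewrite ltNge ms.
Unshelve. all: by end_near. Qed.
End Contraction.

(** * Elements of [N] conjugated by large dilations *)

Section Nilpotent.
Variable R : realType.
Implicit Types (a t : R) (p q v w : Cay R * Cay R).
Implicit Type V : Cay R * Cay R -> Cay R * Cay R.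

(** [phi 0] is idempotent and injective. *)
Lemma one_param0 phi V : one_param_subgroup phi V -> phi 0 = id.
Proof.
move=> [phiG phiD _]; apply: funext => p.
have [[/bij_inj inj _] _] := phiG 0; apply: inj.
by rewrite -[in RHS](addr0 0) phiD.
Qed.

(** The derivative, given at time [0] only, is transported to time [s] by the group law. *)
Lemma flow_curve phi V p (c := fun s => coords (phi s (Aff p.1 p.2))) :
  one_param_subgroup phi V -> H2 p ->
  [/\ c 0 = p, forall s, H2 (c s) & forall s : R, is_derive s 1 c (V (c s))].
Proof.
move=> phiV pH; have [phiG phiD dphi] := phiV.
have cH s : H2 (c s) /\ phi s (Aff p.1 p.2) = Aff (c s).1 (c s).2.
  have [q qH E] := G_H2 (phiG s) pH; by rewrite /c E /= -surjective_pairing.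
split=> [|s|s]; first by rewrite /c (one_param0 phiV); case: (p).
  exact: (cH s).1.
have /derive_diffP d1 := dphi _ (cH s).1.
have d2 : is_derive s 1 (fun r : R => r - s) 1.
  apply: (is_derive_eq (is_deriveB (is_derive_id s (1 : R))
    (is_derive_cst s s 1))).
  by rewrite subr0.
have d3 : is_diff (s - s) (fun h => coords (phi h (Aff (c s).1 (c s).2)))
    (fun h => h *: V (c s)) by rewrite subrr.
have E : c = (fun h => coords (phi h (Aff (c s).1 (c s).2))) \o (fun r => r - s).
  apply/funext => r; rewrite /= -(cH s).2 -[phi _ _]/((phi (r - s) \o phi s) _).
  by rewrite -phiD subrK.
have := is_derive_diff_comp d2 d3; rewrite -E => dc.
by apply: (is_derive_eq dc); rewrite scale1r.
Qed.

Lemma siegel_fieldD V1 V2 w :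
  siegel_field (fun p => V1 p + V2 p) w = siegel_field V1 w + siegel_field V2 w.
Proof.
rewrite /siegel_field /dsiegel; move: (V1 _) (V2 _) => [a b] [c d].
by congr pair => /=; rewrite ?(cmulDr, cmulDl); lin.
Qed.

Section Limits.
Context {T : Type} {F : set_system T} {FF : Filter F}.

Lemma cvg_cmul (f g : T -> Cay R) (x y : Cay R) :
  f t @[t --> F] --> x -> g t @[t --> F] --> y ->
  f t *o g t @[t --> F] --> x *o y.
Proof. by apply: continuous2_cvg; exact: (@cmul_continuous R (x, y)). Qed.

Lemma cvg_cinv (f : T -> Cay R) (x : Cay R) : x != 0 ->
  f t @[t --> F] --> x -> cinv (f t) @[t --> F] --> cinv x.
Proof.
move=> x0; apply: (@continuous_cvg _ _ _ _ _ f (@cinv R)).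
exact/differentiable_continuous/differentiable_cinv.
Qed.

Lemma cvg_cay2 (f g : T -> Cay R) (x y : Cay R) :
  f t @[t --> F] --> x -> g t @[t --> F] --> y ->
  (f t, g t) @[t --> F] --> (x, y).
Proof. by move=> fx gy; exact: (@cvg_pair _ _ _ _ (nbhs x) (nbhs y)). Qed.

Lemma cvg_fst2 (f : T -> Cay R * Cay R) v :
  f t @[t --> F] --> v -> (f t).1 @[t --> F] --> v.1.
Proof. by apply: (@continuous_cvg _ _ _ _ _ f fst); exact: cvg_fst. Qed.

Lemma cvg_snd2 (f : T -> Cay R * Cay R) v :
  f t @[t --> F] --> v -> (f t).2 @[t --> F] --> v.2.
Proof. by apply: (@continuous_cvg _ _ _ _ _ f snd); exact: cvg_snd. Qed.
End Limits.

Lemma unsiegel_continuous w : w.1 != 0 ->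
  unsiegel x @[x --> w] --> unsiegel w.
Proof.
move=> w0; have dq := is_diff_cinv (is_diff_fst w) w0.
have d1 := is_diffB (is_diff_cst (creal 1) w) dq.
have d := is_diff_pair d1 (is_diff_cmul (is_diff_snd w) dq).
exact: (differentiable_continuous (ex_diff (is_diff_def := d))).
Qed.

Lemma siegel_field_continuous V w : (forall p, H2 p -> differentiable V p) ->
  siegel_dom w -> siegel_field V x @[x --> w] --> siegel_field V w.
Proof.
move=> dV wD; have uc := unsiegel_continuous (siegel_dom_neq0 wD).
have Vc : V (unsiegel x) @[x --> w] --> V (unsiegel w).
  have := differentiable_continuous (dV _ (H2_unsiegel wD)).
  exact: continuous_comp.
have i1 : x.1 @[x --> w] --> w.1 by apply: cvg_fst2; exact: cvg_id.
have i2 : x.2 @[x --> w] --> w.2 by apply: cvg_snd2; exact: cvg_id.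
have v1 : (V (unsiegel x)).1 @[x --> w] --> (V (unsiegel w)).1 by exact: cvg_fst2.
have v2 : (V (unsiegel x)).2 @[x --> w] --> (V (unsiegel w)).2 by exact: cvg_snd2.
exact: (cvg_cay2 (cvg_cmul (cvg_cmul i1 v1) i1)
  (cvg_cmul (cvgD v2 (cvg_cmul i2 v1)) i1)).
Qed.

Lemma dil_curve (f : R -> Cay R * Cay R) (s : R) a v : is_derive s 1 f v ->
  is_derive s 1 (fun s => dil a (f s)) (a ^+ 2 *: v.1, a *: v.2).
Proof.
move=> df; have d1 := curve_fst df; have d2 := curve_snd df.
have c1 := is_derive_cst (creal 2^-1 : Cay R) s 1.
have d3 := is_deriveD (is_deriveZ (a ^+ 2) (is_deriveB d1 c1)) c1.
apply: (is_derive_eq (curve_pair d3 (is_deriveZ a d2))).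
by rewrite addr0 subr0.
Qed.

(** Rescaling by [r = n + 1] multiplies the field of weight [1] by [r^-1] and that of weight [2] by
    [r^-2], in both components. The rescaled flow thus has the form required by [trapped], with the
    small parameter [r^-1]. *)
Lemma N_contract g w (q := fun n : nat => unsiegel (dil n.+1%:R w)) :
  N g -> siegel_dom w ->
  dil n.+1%:R^-1 (siegel (coords (g (Aff (q n).1 (q n).2)))) @[n --> \oo] --> w.
Proof.
move=> [V1 [V2 [phi [V1r V2r phiV ->]]]] wD.
have c1 := siegel_field_continuous V1r.1.1 wD.
have c2 := siegel_field_continuous V2r.1.1 wD.
apply/cvgrPdist_lt => e e0.
have [r0 r0_gt0 trap] := trapped c1 c2 e0.
near=> n; rewrite distrC.
set r : R := n.+1%:R.
have r_gt0 : 0 < r by rewrite ltr0n.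
have rE : expR (ln r) = r by rewrite lnK.
have WD : siegel_dom (dil r w) by exact: siegel_dom_dil.
have qH : H2 (q n) by exact: H2_unsiegel.
have [g0 gH dg] := flow_curve phiV qH.
pose c s := coords (phi s (Aff (q n).1 (q n).2)).
apply: (trap r^-1 (fun s => dil r^-1 (siegel (c s)))).
- rewrite invr_gt0 r_gt0 /=.
  by rewrite /r; near: n; exact: (near_infty_natSinv_lt (PosNum r0_gt0)).
- rewrite /c g0 /q unsiegelK; last exact: siegel_dom_neq0.
  by rewrite dilM mulVf ?gt_eqF // dil1.
move=> s; set P := dil r^-1 (siegel (c s)).
have sD : siegel_dom (siegel (c s)) by exact: siegel_dom_siegel (gH s).
have PD : siegel_dom P by apply: siegel_dom_dil sD; rewrite invr_gt0.
have sP : siegel (c s) = dil (expR (ln r)) P.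
  by rewrite /P dilM rE mulfV ?gt_eqF // dil1.
have ds := is_derive_diff_comp (dg s) (is_diff_siegel (H2_neq1 (gH s))).
apply: (is_derive_eq (dil_curve r^-1 ds)).
have -> : dsiegel (siegel (c s)) (V1 (c s) + V2 (c s)) =
    siegel_field V1 (siegel (c s)) + siegel_field V2 (siegel (c s)).
  by rewrite -siegel_fieldD /siegel_field (siegelK (gH s)).
rewrite sP (siegel_field_dil _ V1r PD) (siegel_field_dil _ V2r PD).
have -> : (2 - 1) * ln r = ln r by ring.
have -> : (1 - 2) * ln r = - ln r by ring.
rewrite !subrr !mul0r expR0 expRN rE.
case: (siegel_field V1 P) (siegel_field V2 P) => [a b] [a' b'].
have r_neq0 : r != 0 by rewrite gt_eqF.
congr pair => /=; rewrite scalerDr ?scale1r !scalerA.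
  by congr (_ *: _ + _); field.
by congr (_ + _ *: _); field.
Unshelve. all: by end_near. Qed.
End Nilpotent.

(** * The centre of N *)

Section Center.
Variable R : realType.
Implicit Types (a : R) (x y z : Cay R) (p q v w : Cay R * Cay R).

Lemma ImCayP y : ImCay y <-> cconj y = - y.
Proof.
split; first exact: ImCay_conj.
rewrite /ImCay /= /cIm => ->.
by apply: crdP => k _; rewrite crdZ !(crdD, crdN); field.
Qed.

Lemma ImCayZ a y : ImCay y -> ImCay (a *: y).
Proof. by move=> /ImCayP yE; apply/ImCayP; rewrite cconjZ yE scalerN. Qed.

Lemma ImCay_crd0 y : ImCay y -> crd y 0 = 0.
Proof.
move=> /ImCayP /(congr1 (fun z : Cay R => crd z 0)); rewrite !crdE => E; lra.
Qed.

Lemma siegel_dom_shift w y : ImCay y -> siegel_dom w -> siegel_dom (w.1 + y, w.2).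
Proof. by move=> /ImCay_crd0 y0; rewrite /siegel_dom /= crdD y0 addr0. Qed.

Lemma vertical_siegel y p (w := siegel p) : ImCay y -> H2 p ->
  vertical y (Aff p.1 p.2) =
  Aff (unsiegel (w.1 + y, w.2)).1 (unsiegel (w.1 + y, w.2)).2.
Proof.
move=> yI pH; have p1 := H2_neq1 pH.
have := siegel_dom_neq0 (siegel_dom_shift yI (siegel_dom_siegel pH)).
by rewrite /vertical /w /siegel /unsiegel /= (negbTE p1) /= => /negbTE ->.
Qed.

Definition vertical_field y p :=
  ((creal 1 - p.1) *o y *o (creal 1 - p.1), - (p.2 *o y *o (creal 1 - p.1))).

Lemma vertical_one_param y : ImCay y ->
  one_param_subgroup (fun s => vertical (s *: y)) (vertical_field y).
Proof.
move=> yI; split=> [s|s t|p pH]; first exact/vertical_G/ImCayZ.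
  by rewrite scalerDl verticalD.
have -> : (fun s => coords (vertical (s *: y) (Aff p.1 p.2))) =
    (fun s => unsiegel ((siegel p).1 + s *: y, (siegel p).2)).
  by apply/funext => s; rewrite vertical_siegel //; exact: ImCayZ.
have d0 : is_derive (0 : R) 1 (fun s => (siegel p).1 + s *: y) y.
  apply: (is_derive_eq (is_deriveD (is_derive_cst (siegel p).1 (0 : R) 1)
    (curve_scale y (is_derive_id (0 : R) (1 : R))))).
  by rewrite scale1r add0r.
have z0 : (siegel p).1 != 0 by apply/siegel_dom_neq0/siegel_dom_siegel.
have d1 := curve_inv d0; rewrite scale0r addr0 in d1; have {}d1 := d1 z0.
apply: (is_derive_eq (curve_pair
  (is_deriveB (is_derive_cst (creal 1 : Cay R) (0 : R) 1) d1)
  (curve_mul (is_derive_cst (siegel p).2 (0 : R) 1) d1))).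
have p1 := H2_neq1 pH.
rewrite sub0r opprK cmul0l add0r cmulNr moufang_right /siegel /= cinvK.
by rewrite cmulVKr.
Qed.

Lemma is_diff_vertical_field y p : is_diff p (vertical_field y)
  (fun v => (- (((creal 1 - p.1) *o y) *o v.1 + (v.1 *o y) *o (creal 1 - p.1)),
             (p.2 *o y) *o v.1 - (v.2 *o y) *o (creal 1 - p.1))).
Proof.
have d1 : is_diff p (fun q : Cay R * Cay R => creal 1 - q.1) (fun v => - v.1).
  apply: (is_diff_eq (is_diffB (is_diff_cst (creal 1) p) (is_diff_fst p))).
  by apply/funext => v; apply: sub0r.
have dy : is_diff p (fun _ : Cay R * Cay R => y) (fun _ => 0) := is_diff_cst y p.
have d2 := is_diff_cmul (is_diff_cmul d1 dy) d1.
have d3 := is_diff_cmul (is_diff_cmul (is_diff_snd p) dy) d1.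
apply: (is_diff_eq (is_diff_pair d2 (is_diffN d3))); apply/funext => v.
congr pair => /=; first by rewrite cmul0r add0r cmulNr !cmulNl -opprD.
by rewrite -[LHS]/(- (_ + _)) cmul0r add0r cmulNr opprD opprK.
Qed.

Lemma vertical_field_ad y p :
  'd (@XAf R) p (vertical_field y p) - 'd (vertical_field y) p (XAf p) =
  2 *: vertical_field y p.
Proof.
have sub_eq (U : zmodType) (A B C D : U) : A = C -> B = D -> A - B = C - D.
  by move=> -> ->.
apply: (etrans (sub_eq _ _ _ _ _ (congr1 (@^~ (vertical_field y p))
    (diff_val (is_diff_def := is_diff_XAf p)))
  (congr1 (@^~ (XAf p)) (diff_val (is_diff_def := is_diff_vertical_field y p))))).
case: p => x1 x2; rewrite /vertical_field /XAf /=.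
(* In terms of [b = 1 - x1] the field is [(b y b, - (x2 y) b)], and alternativity and the Moufang
   identity suffice. *)
have -> : x1 = creal 1 - (creal 1 - x1) by rewrite subKr.
rewrite ![creal 1 - (creal 1 - (creal 1 - x1))]subKr; move: (creal 1 - x1) => b.
congr pair => /=.
  have F1 := cmul_altr (b *o y) b.
  have F2 : b *o (b *o y *o b) = ((b *o b) *o y) *o b.
    by rewrite -cmul_flex cmul_altl.
  rewrite !(cmulBl, cmulBr, cmulDl, cmulDr, cmulNl, cmulNr, cmul1l, cmul1r) F1 F2.
  lin.
have F1 := cmul_altr (x2 *o y) b; have F2 := moufang_right x2 b y.
rewrite !(cmulBl, cmulBr, cmulDl, cmulDr, cmulNl, cmulNr, cmul1l, cmul1r) F1 F2.
lin.
Qed.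

Lemma vertical_root_space y : ImCay y -> root_space 2 (vertical_field y).
Proof.
move=> yI; split; last by move=> p _; rewrite /ad XAE vertical_field_ad.
split=> [p _|]; last by exists (fun s => vertical (s *: y)); exact: vertical_one_param.
exact: (ex_diff (is_diff_def := is_diff_vertical_field y p)).
Qed.

(** Supplies the [g_alpha] component of the vertical translations. *)
Lemma zero_root_space a : root_space a (fun _ : Cay R * Cay R => 0).
Proof.
split; last first.
  move=> p _; rewrite /ad scaler0.
  have z1 : 'd (@XA R) p 0 = 0 by exact: linear0.
  have z2 : 'd (fun _ : Cay R * Cay R => 0 : Cay R * Cay R) p (XA p) = 0.
    exact: (congr1 (@^~ (XA p)) (diff_cst _ p)).
  have sub_eq (U : zmodType) (A B : U) : A = 0 -> B = 0 -> A - B = 0.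
    by move=> -> ->; rewrite subrr.
  exact: (sub_eq _ _ _ z1 z2).
split=> [p _|]; first exact: differentiable_cst.
exists (fun _ => id); split=> [s|s t|p _] //; first exact: G_id.
exact: is_derive_cst.
Qed.

Lemma vertical_N y : ImCay y -> N (vertical y).
Proof.
move=> yI; exists (fun _ => 0), (vertical_field y), (fun s => vertical (s *: y)).
split; last by rewrite scale1r.
- exact: zero_root_space.
- exact: vertical_root_space.
have -> : (fun p => 0 + vertical_field y p) = vertical_field y.
  by apply/funext => p; rewrite add0r.
exact: vertical_one_param.
Qed.

Lemma origin_H2 : H2 (0 : Cay R * Cay R).
Proof. by rewrite H2E /= cnorm0 addr0 ltr01. Qed.

Lemma vertical_origin y (w := creal (cabs (0 : Cay R) ^+ 2 / 2) + y) : ImCay y ->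
  vertical y (Aff 0 0) =
  Aff (w *o cinv (creal 1 + w)) (0 *o cinv (creal 1 + w)).
Proof.
move=> yI; have -> : w = y.
  by rewrite /w /cabs cnorm0 sqrtr0 expr2 mul0r mul0r creal0 add0r.
rewrite (vertical_siegel yI origin_H2) /siegel /unsiegel /= subr0.
rewrite cinv_real invr1 !cmul0l; congr Aff.
have y1 : creal 1 + y != 0.
  have := siegel_dom_neq0 (siegel_dom_shift yI (siegel_dom_siegel origin_H2)).
  by rewrite /siegel /= subr0 cinv_real invr1.
have := cmulxV y1; rewrite cmulDl cmul1l.
by set c := cinv _ => E; apply: (addIr c); rewrite subrK addrC E.
Qed.

Lemma vertical_formula x1 x2 y : H2 (x1, x2) -> ImCay y ->
  vertical y (Aff x1 x2) =
    Aff (((creal 1 - y) *o x1 + y) *o cinv (- (y *o x1) + creal 1 + y))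
        ((x2 *o (creal 1 - cconj x1)) *o
          (cinv (creal 1 - cconj x1) *o cinv (- (y *o x1) + creal 1 + y))).
Proof.
move=> xH yI; rewrite (vertical_siegel yI xH) /siegel /unsiegel /=.
have := H2_neq1 xH; rewrite /=; set b := creal 1 - x1 => b0.
have w0 := siegel_dom_neq0 (siegel_dom_shift yI (siegel_dom_siegel xH)).
rewrite /siegel /= -/b in w0.
set D := - (y *o x1) + creal 1 + y.
(* With [D = 1 + y b] one gets [b^-1 + y = D b^-1], whose inverse is [b D^-1]. *)
have DE : D = creal 1 + y *o b by rewrite /D /b cmulBr cmul1r; lin.
have wE : cinv b + y = D *o cinv b by rewrite DE cmulDl cmul1l cmulKr.
have D0 : D != 0 by apply: contraNneq w0 => D0; rewrite wE D0 cmul0l.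
have iE : cinv (cinv b + y) = b *o cinv D by rewrite wE cinv_mul cinvK.
rewrite iE; congr Aff.
  have -> : (creal 1 - y) *o x1 + y = D - b.
    by rewrite cmulBl cmul1l DE /b cmulBr cmul1r; lin.
  by rewrite (cmulBl D b) (cmulxV D0).
have -> : creal 1 - cconj x1 = cconj b by rewrite /b cconjD cconjN cconj_real.
have N0 : cnorm b != 0 by rewrite cnorm_eq0.
(* [cconj b] is a real multiple of [b^-1]: up to real factors that cancel, [1 - cconj x1] and its
   inverse stand for [b^-1] and [b]. *)
have cbE : cconj b = cnorm b *: cinv b.
  by rewrite /cinv scalerA mulfV // scale1r.
rewrite cbE cinvZ cinvK (cmulZr (cnorm b)) (cmulZl (cnorm b)).
by rewrite (cmulZl (cnorm b)^-1) (cmulZr (cnorm b)^-1) scalerA mulfV // scale1r.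
Qed.

End Center.

(** * Uniqueness *)

Section Uniqueness.
Variable R : realType.
Implicit Types (x y z : Cay R) (p q v w : Cay R * Cay R).

Local Notation half := (creal 2^-1 : Cay R).

Lemma cnorm_continuous : continuous (@cnorm R).
Proof.
have -> : @cnorm R = (fun y => (y *o cconj y) 0 (inord 0)).
  by apply/funext => z; rewrite cmul_conj -/(crd _ _) crdE.
move=> x; have c1 : y @[y --> x] --> x by exact: cvg_id.
have c2 : y *o cconj y @[y --> x] --> x *o cconj x.
  exact: (cvg_cmul c1 (@cconj_continuous R x)).
exact: (cvg_comp _ _ c2 (@coord_continuous R 1 8 0 (inord 0) (x *o cconj x))).
Qed.

Lemma N2_continuous : continuous (@N2 R).
Proof.
move=> v; have c1 : q.1 @[q --> v] --> v.1 by apply: cvg_fst2; exact: cvg_id.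
have c2 : q.2 @[q --> v] --> v.2 by apply: cvg_snd2; exact: cvg_id.
exact: (cvgD (cvg_comp _ _ c1 (@cnorm_continuous v.1))
  (cvg_comp _ _ c2 (@cnorm_continuous v.2))).
Qed.

Lemma cay2_norm_le_N2 v : `|v| <= Num.sqrt (N2 v).
Proof.
apply: cay2_norm_le => [|i|i]; rewrite ?sqrtr_ge0 // -sqrtr_sqr ler_wsqrtr //.
  by rewrite (le_trans (sqr_crd_le_cnorm _ _)) // lerDl cnorm_ge0.
by rewrite (le_trans (sqr_crd_le_cnorm _ _)) // lerDr cnorm_ge0.
Qed.

Section Isometry.
Variable f : Cay R * Cay R -> Cay R * Cay R.
Hypotheses (fB : forall p q, f (p - q) = f p - f q) (fN : forall p, N2 (f p) = N2 p).

Lemma isometry_continuous p : f x @[x --> p] --> f p.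
Proof.
apply/cvgrPdist_lt => e e0.
have c1 : p - x @[x --> p] --> p - p by apply: cvgB; [exact: cvg_cst|exact: cvg_id].
have c2 : N2 (p - x) @[x --> p] --> N2 (p - p).
  exact: (cvg_comp _ _ c1 (@N2_continuous (p - p))).
have c3 : \forall x \near p, N2 (p - x) < e ^+ 2.
  by apply: (cvgr_lt _ c2); rewrite subrr /N2 /= cnorm0 addr0 exprn_gt0.
near=> x; rewrite -fB (le_lt_trans (cay2_norm_le_N2 _)) // fN.
rewrite -[e]gtr0_norm // -sqrtr_sqr ltr_sqrt ?exprn_gt0 //.
by near: x; exact: c3.
Unshelve. all: by end_near. Qed.

Lemma isometry_lim (s t : nat -> Cay R * Cay R) v w :
  s @ \oo --> v -> (forall n, f (s n) = t n) -> t @ \oo --> w -> f v = w.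
Proof.
move=> sv fst tw; have ft : f (s n) @[n --> \oo] --> f v.
  exact: (cvg_comp _ _ sv (isometry_continuous (p := v))).
have E : t = (fun n => f (s n)) by apply/funext.
by rewrite E in tw; exact: (cvg_unique _ ft tw).
Qed.
End Isometry.

(** [u n] is [dil (n + 1) (s n)] followed by the translation by [c - 1/2]. Once [(n + 1)^2] is
    factored out of its first component, [c] disappears in the limit. *)
Lemma unsiegel_asymptotics (s : nat -> Cay R * Cay R) w c :
  s @ \oo --> w -> w.1 - half != 0 ->
  let u n := (n.+1%:R ^+ 2 *: ((s n).1 - half) + c, n.+1%:R *: (s n).2) in
  (n.+1%:R ^+ 2 *: cinv (u n).1 @[n --> \oo] --> cinv (w.1 - half)) /\
  (n.+1%:R *: ((u n).2 *o cinv (u n).1) @[n --> \oo] --> w.2 *o cinv (w.1 - half)).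
Proof.
move=> sw m0 u; pose r n : R := n.+1%:R.
have r0 n : r n != 0 by rewrite pnatr_eq0.
have r20 n : r n ^+ 2 != 0 by rewrite expf_neq0.
have s1 : (s n).1 @[n --> \oo] --> w.1 by exact: cvg_fst2.
have s2 : (s n).2 @[n --> \oo] --> w.2 by exact: cvg_snd2.
have ic : (r n)^-1 ^+ 2 *: c @[n --> \oo] --> (0 : Cay R).
  have h : (r n)^-1 @[n --> \oo] --> (0 : R) by exact: cvg_harmonic.
  have h2 : (r n)^-1 * (r n)^-1 @[n --> \oo] --> (0 * 0 : R) by exact: cvgM.
  rewrite mul0r in h2; rewrite -(scale0r c).
  by apply: cvgZl.
have d0 : (s n).1 - half @[n --> \oo] --> w.1 - half.
  exact: (cvgB s1 (cvg_cst _)).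
have d1 : (s n).1 - half + (r n)^-1 ^+ 2 *: c @[n --> \oo] --> w.1 - half.
  by rewrite -[w.1 - half]addr0; exact: (cvgD d0 ic).
have uE n : (u n).1 = r n ^+ 2 *: (((s n).1 - half) + (r n)^-1 ^+ 2 *: c).
  by rewrite scalerDr scalerA -exprMn mulfV // expr1n scale1r.
have d2 : cinv ((s n).1 - half + (r n)^-1 ^+ 2 *: c) @[n --> \oo] -->
    cinv (w.1 - half) by exact: (cvg_cinv m0 d1).
split.
  have -> : (fun n => n.+1%:R ^+ 2 *: cinv (u n).1) =
      (fun n => cinv ((s n).1 - half + (r n)^-1 ^+ 2 *: c)).
    by apply/funext => n; rewrite uE cinvZ scalerA (mulfV (r20 n)) scale1r.
  exact: d2.
have -> : (fun n => n.+1%:R *: ((u n).2 *o cinv (u n).1)) =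
    (fun n => (s n).2 *o cinv ((s n).1 - half + (r n)^-1 ^+ 2 *: c)).
  apply/funext => n; rewrite uE cinvZ (cmulZr (r n ^+ 2)^-1) (cmulZl (r n)) !scalerA.
  by rewrite -/(r n) mulrAC -expr2 (mulfV (r20 n)) scale1r.
exact: (cvg_cmul s2 d2).
Qed.

Definition boundary_point : Cay R * Cay R := (creal 1, 0).
Local Notation e := boundary_point.

(** None of the limits depends on [c], nor on [s] beyond its limit [w]; this makes an orbit
    comparable with its image under [f]. *)
Lemma unsiegel_limits (s : nat -> Cay R * Cay R) w c
    (q := fun n => unsiegel
      (n.+1%:R ^+ 2 *: ((s n).1 - half) + c, n.+1%:R *: (s n).2)) :
  s @ \oo --> w -> w.1 - half != 0 ->
  [/\ q @ \oo --> e,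
      n.+1%:R *: (e - q n) @[n --> \oo] -->
        (0 : Cay R, - (w.2 *o cinv (w.1 - half))) &
      n.+1%:R ^+ 2 *: (e - q n).1 @[n --> \oo] --> cinv (w.1 - half)].
Proof.
move=> sw m0; have [S T] := unsiegel_asymptotics c sw m0.
pose r n : R := n.+1%:R.
have r0 n : r n != 0 by rewrite pnatr_eq0.
have h : (r n)^-1 @[n --> \oo] --> (0 : R) by exact: cvg_harmonic.
set i := cinv _ in S T *.
have eq1 n : (e - q n).1 = cinv (r n ^+ 2 *: ((s n).1 - half) + c).
  by rewrite /q /unsiegel /= subKr.
have eq2 n : (e - q n).2 =
    - ((r n *: (s n).2) *o cinv (r n ^+ 2 *: ((s n).1 - half) + c)).
  by rewrite /q /unsiegel /= sub0r.
have A3 : n.+1%:R ^+ 2 *: (e - q n).1 @[n --> \oo] --> i.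
  by under eq_fun do rewrite eq1; exact: S.
have A2 : n.+1%:R *: (e - q n) @[n --> \oo] --> (0 : Cay R, - (w.2 *o i)).
  have -> : (fun n => n.+1%:R *: (e - q n)) =
     (fun n => ((r n)^-1 *: (n.+1%:R ^+ 2 *: (e - q n).1), n.+1%:R *: (e - q n).2)).
    apply/funext => n; rewrite [e - q n]surjective_pairing; congr pair => //=.
    by rewrite scalerA expr2 mulKf.
  apply: cvg_cay2.
    by rewrite -(scale0r i); exact: (cvgZ h A3).
  under eq_fun do rewrite eq2 scalerN.
  exact: (cvgN T).
split=> //.
have A1 : (r n)^-1 *: (n.+1%:R *: (e - q n)) @[n --> \oo] --> (0 : Cay R * Cay R).
  by rewrite -(scale0r (0 : Cay R, - (w.2 *o i))); exact: (cvgZ h A2).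
have -> : q = (fun n => e - (r n)^-1 *: (n.+1%:R *: (e - q n))).
  by apply/funext => n; rewrite scalerA mulVf // scale1r subKr.
have A0 : e - (r n)^-1 *: (n.+1%:R *: (e - q n)) @[n --> \oo] --> e - 0.
  exact: (cvgB (cvg_cst e) A1).
by rewrite subr0 in A0.
Qed.

Lemma N_G g : @N R g -> G g.
Proof. by move=> [V1 [V2 [phi [_ _ [phiG _ _] ->]]]]. Qed.

Lemma N_unique g y p : N g -> ImCay y ->
  g (Aff 0 0) = vertical y (Aff 0 0) -> H2 p ->
  g (Aff p.1 p.2) = vertical y (Aff p.1 p.2).
Proof.
move=> Ng yI g0 pH; have Gg := N_G Ng.
have nI : ImCay (- y) by rewrite -scaleN1r; exact: ImCayZ.
have vK : cancel (vertical y) (vertical (- y)).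
  move=> a; rewrite -[LHS]/((vertical (- y) \o vertical y) a).
  by rewrite -verticalD addNr vertical0.
have v'K : cancel (vertical (- y)) (vertical y).
  move=> a; rewrite -[LHS]/((vertical y \o vertical (- y)) a).
  by rewrite -verticalD addrN vertical0.
pose k := vertical (- y) \o g.
have Gk : G k by apply: G_comp => //; exact: vertical_G.
have k0 : k (Aff 0 0) = Aff 0 0 by rewrite /k /= g0 vK.
pose f := affine_part k.
have fD := affine_partD Gk k0 : forall p q, f (p + q) = f p + f q.
have fB := affine_partB Gk k0 : forall p q, f (p - q) = f p - f q.
have fN := affine_part_N2 Gk k0 : forall p, N2 (f p) = N2 p.
have fZ (n : nat) v : f (n%:R *: v) = n%:R *: f v.
  by rewrite (scaler_nat n v) (scaler_nat n (f v)) /f (affine_partMn Gk k0).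
suff fE v : f v = v.
  apply: (can_inj v'K); rewrite vK -[LHS]/(k _) (stab_affine Gk k0) -/(f p) fE.
  done.
pose q w (n : nat) := unsiegel (dil n.+1%:R w).
(* The image of the orbit is again a dilated convergent sequence, with [half - y] in place of [half]
   because [k] ends with the translation by [- y]. *)
have fq w : siegel_dom w -> exists2 s : nat -> Cay R * Cay R, s @ \oo --> w &
    forall n, f (q w n) =
     unsiegel (n.+1%:R ^+ 2 *: ((s n).1 - half) + (half - y), n.+1%:R *: (s n).2).
  move=> wD.
  exists (fun n => dil n.+1%:R^-1 (siegel (coords (g (Aff (q w n).1 (q w n).2))))).
    exact: N_contract.
  move=> n; set r : R := n.+1%:R.
  have r_gt0 : 0 < r by rewrite ltr0n.
  have qH : H2 (q w n) by apply/H2_unsiegel/siegel_dom_dil.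
  have [t tH E] := G_H2 Gg qH.
  rewrite /f /affine_part /k /= E (vertical_siegel nI tH).
  rewrite -[LHS]/(unsiegel ((siegel t).1 - y, (siegel t).2)); congr unsiegel.
  have -> : coords (Aff t.1 t.2) = t by case: (t).
  rewrite /siegel /= addrK !scalerA -exprMn mulfV ?gt_eqF // expr1n !scale1r.
  by congr pair; lin.
have m0 w : siegel_dom w -> w.1 - half != 0.
  move=> wD; apply/eqP => /eqP; rewrite subr_eq0 => /eqP wE; move: wD.
  by rewrite /siegel_dom wE crdE mulfV ?pnatr_eq0 // subrr ltNge cnorm_ge0.
have lim w : siegel_dom w ->
    [/\ f e = e,
        f (0, - (w.2 *o cinv (w.1 - half))) = (0, - (w.2 *o cinv (w.1 - half))) &
        w.2 = 0 -> f (cinv (w.1 - half), 0) = (cinv (w.1 - half), 0)].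
  move=> wD; have [s sw fs] := fq w wD.
  have [B1 B2 B3] := unsiegel_limits (half - y) sw (m0 w wD).
  have c1 : (fun _ : nat => w) @ \oo --> w by exact: cvg_cst.
  have [A1 A2 A3] := unsiegel_limits half c1 (m0 w wD).
  have fe : f e = e.
    exact: (isometry_lim fB fN A1 fs B1).
  split=> //.
    apply: (isometry_lim fB fN A2 _ B2) => n.
    by rewrite fZ fB fe fs.
  move=> w2; set i := cinv _ in B3 A3 *.
  (* When [w.2 = 0] the differences [e - q w n] lie in [Cay x 0], so the factor [(n + 1)^2] does not
     make the second coordinate diverge. *)
  have a1 : (n.+1%:R ^+ 2 *: (e - q w n).1, 0 : Cay R) @[n --> \oo] -->
      (i, 0 : Cay R) by exact: (cvg_cay2 A3 (cvg_cst _)).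
  have a2 := cvg_comp _ _ a1 (isometry_continuous fB fN (p := (i, 0))).
  have a3 : (f (n.+1%:R ^+ 2 *: (e - q w n).1, 0)).1 @[n --> \oo] --> (f (i, 0)).1.
    exact: (cvg_fst2 a2).
  have E1 : (f (i, 0)).1 = i.
    pose z n := unsiegel
      (n.+1%:R ^+ 2 *: ((s n).1 - half) + (half - y), n.+1%:R *: (s n).2).
    have E : (fun n => (f (n.+1%:R ^+ 2 *: (e - q w n).1, 0)).1) =
        (fun n => n.+1%:R ^+ 2 *: (e - z n).1).
      apply/funext => n; have -> : (n.+1%:R ^+ 2 *: (e - q w n).1, 0) =
          (n.+1 ^ 2)%:R *: (e - q w n).
        rewrite natrX [e - q w n]surjective_pairing; congr pair => /=.
        by rewrite w2 scaler0 cmul0l subrr scaler0.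
      by rewrite fZ fB fe fs natrX.
    by rewrite E in a3; exact: (cvg_unique _ a3 B3).
  (* The limit controls only the first coordinate of [f (i, 0)]; since [f] preserves [N2], the
     second one vanishes. *)
  have := fN (i, 0); rewrite /N2 E1 /= => /addrI; rewrite cnorm0 => /eqP.
  by rewrite cnorm_eq0 => /eqP E2; rewrite [LHS]surjective_pairing E1 E2.
have f2 x : f (0, x) = (0, x).
  (* The choice [w.1 - 1/2 = M] and [w.2 = - M x] produces the limit [(0, x)]; this [M] is small
     enough for [M^2 |x|^2 < 2 M], the condition of the Siegel domain. *)
  pose M := (cnorm x + 1)^-1.
  have Nx := cnorm_ge0 x.
  have M0 : 0 < M by rewrite invr_gt0 ltr_wpDl.
  have wD : siegel_dom (creal (M + 2^-1), M *: - x).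
    rewrite /siegel_dom /= cnormZ cnormN crdE.
    have MN : M * (cnorm x + 1) = 1 by rewrite mulVf // gt_eqF // ltr_wpDl.
    have : M * (M * (cnorm x + 1)) = M by rewrite MN mulr1.
    nra.
  have [_ + _] := lim _ wD; rewrite /=.
  have -> : creal (M + 2^-1) - half = creal M by rewrite crealD addrK.
  rewrite cinv_real cmul_realr scalerA mulVf ?gt_eqF // scale1r opprK.
  exact.
have f1 x : 0 < crd x 0 -> f (x, 0) = (x, 0).
  move=> x0; have wD : siegel_dom (cinv x + half, 0).
    rewrite /siegel_dom /= cnorm0 crdD crdE crd_cinv0.
    have : 0 < (cnorm x)^-1 * crd x 0.
      rewrite mulr_gt0 // invr_gt0 cnorm_gt0; apply: contraTneq x0 => ->.
      by rewrite crd0 ltxx.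
    lra.
  by have [_ _ /(_ erefl)] := lim _ wD; rewrite /= addrK cinvK.
have f1' x : f (x, 0) = (x, 0).
  (* Adding a large real number makes the real part positive. *)
  pose r := `|crd x 0| + 1.
  have r0 : 0 < crd (creal r) 0 by rewrite crdE ltr_wpDl.
  have xr0 : 0 < crd (x + creal r) 0.
    by rewrite crdD crdE /r; have := ler_norm (- crd x 0); rewrite normrN; lra.
  have -> : (x, 0) = (x + creal r, 0) - (creal r, 0) :> Cay R * Cay R.
    by congr pair; rewrite /= ?addrK ?subrr.
  by rewrite fB !f1.
have -> : v = (v.1, 0) + (0, v.2).
  by case: (v) => a b; congr pair; rewrite /= ?addr0 ?add0r.
by rewrite fD f1' f2.
Qed.
End Uniqueness.

Theorem corollary4p3 (R : realType) (x1 x2 y : Cay R) :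
  H2 (x1, x2) -> ImCay y ->
  u y 0 (Aff x1 x2) =
    Aff (((creal 1 - y) *o x1 + y) *o cinv (- (y *o x1) + creal 1 + y))
        ((x2 *o (creal 1 - cconj x1)) *o
          (cinv (creal 1 - cconj x1) *o cinv (- (y *o x1) + creal 1 + y))).
Proof.
move=> xH yI; rewrite -vertical_formula // /u /=.
set S := (S in xget _ S).
(* [vertical y] witnesses that the set defining [u y 0] is inhabited, so the choice satisfies the
   two conditions instead of falling back to [id]. *)
have [Ng g0] : S (xget (id : {classic Defs.cpoint R -> Defs.cpoint R}) S).
  apply: (@xgetPex {classic Defs.cpoint R -> Defs.cpoint R}); exists (vertical y).
  by split; [exact: vertical_N|exact: vertical_origin].
apply: (N_unique Ng yI _ xH).
by rewrite g0 (vertical_origin yI).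
Qed.
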